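(* Let $B=\{I_j\}_{j=1}^N$ be a barcode where $I_1=[b_1,\infty)$ and where for $j\ge 2$ we have a strict containment $I_j=[b_j,d_j)\subset I_1$ with $d_j>d_{j+1}$. Denote the set of intervals in $B$ containing $I_j$ by $C_B(I_j):=\{I_k\in B\mid I_k\supsetneq I_j\}$ and let $\mu_B(I_j)$ denote the cardinality of this set. The number of merge trees realizing the barcode $B$ is $$|\Xi^{-1}(B)|=\prod_{j=2}^N\mu_B(I_j),$$ where $\Xi:\mathcal T\to\mathcal B$ is the Elder map.
   Context: **Barcodes.** A barcode is a multiset of intervals of $\mathbb{R}$, each with finite multiplicity; $\mathcal{B}$ is the set of all barcodes. **Merge trees.** A merge tree is a connected, locally finite, contractible one-dimensional cell complex $T$ with a distinguished edge $e_\infty$ without compact closure, such that $T\setminus e_\infty$ is a compact tree rooted at $v_\infty$, the one vertex incident to $e_\infty$, together with a continuous map $\pi:T\to\mathbb{R}$ such that $\pi(e_\infty)=(\pi(v_\infty),\infty)$ and, for every injective path $\gamma:[0,1]\to T$ starting at a vertex and ending at $v_\infty$, $\pi\circ\gamma$ is monotonically increasing. Merge trees are isomorphic if there is a homeomorphism between them commuting with the maps to $\mathbb{R}$ (vertices that merely subdivide an edge may be removed). **Morse sets.** A Morse set is a functor $S:(\mathbb{R},\le)\to$ finite sets, with shift maps $\varphi_{tr}:S(r)\to S(t)$ for $r\le t$, together with a finite minimal set of times $\tau_1<\dots<\tau_n$ such that: (1) $S(t)=\varnothing$ for $t<\tau_1$; (2) $S|_{[\tau_i,\tau_{i+1})}$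 is naturally isomorphic to the constant functor with value $S(\tau_i)$ for $1\le i\le n-1$; (3) $S(t)$ is a one-point set for $t\ge\tau_n$; (4) for every $x\in S(\tau_{i+1})$, the fiber $\varphi_{\tau_{i+1}\tau_i}^{-1}(x)$ has cardinality $0$, $1$ or $2$; (5) each $y\in S(t)$ is contained in a unique oldest maximal chain of the poset $P_S$. Here $P_S=\bigcup_t S(t)\times\{t\}$ with $(x,r)\preceq(y,t)$ iff $r\le t$ and $\varphi_{tr}(x)=y$, and $\pi:P_S\to\mathbb{R}$ is the projection; a chain $C_1$ is older than a chain $C_2$ if some $t_1\in\pi(C_1)$ satisfies $t_1<t_2$ for all $t_2\in\pi(C_2)$. **Elder Rule.** Let $P_1=P_S$ and let $C_1$ be the oldest maximal chain containing the element of $P_1$ over $\tau_n$. Inductively set $P_{i+1}=P_i\setminus C_i$; if it is nonempty, let $\tau_k$ be the largest of the times $\tau_1,\dots,\tau_n$ over which $P_{i+1}$ has an element, take an element of $P_{i+1}$ over $\tau_k$, and let $C_{i+1}$ be the oldest maximal chain of $P_{i+1}$ containing it. The resulting multiset of intervals $E(S)=\{\pi(C_i)\}$ is the barcode associated to $S$ by the Elder Rule. **Elder map.** The merge tree associated to a Morse set $S$ is $\left(\bigsqcup_{i=1}^{n-1}S(\tau_i)\times[\tau_i,\tau_{i+1}]\sqcup S(\tau_n)\times[\tau_n,\infty)\right)/\!\sim$, where $(x,\tau_{i+1})$ with $x\in S(\tau_i)$ is identified with $(\varphi_{\tau_{i+1}\tau_i}(x),\tau_{i+1})$, projected to the second factor.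 A Morse tree is a merge tree associated to a Morse set; $\mathcal T$ is the set of isomorphism classes of Morse trees. The Elder map $\Xi:\mathcal T\to\mathcal B$ sends $\pi:T\to\mathbb{R}$ to $E(S)$, where $S(t)=\pi_0(\pi^{-1}(-\infty,t])$.
   Formalization: The formula is proved for pairwise distinct b_j; with ties it fails (for {[0,∞),[0,1)} the product is 1 but no Morse tree realizes B). For arbitrary b_j the count is proved with only those I_k ⊋ I_j having b_k < b_j. *)

(* Defs.v *)
From HB Require Import structures.
From Stdlib Require Import Relation_Operators.
From mathcomp Require Import all_boot all_order all_algebra.
From mathcomp Require Import finmap generic_quotient.
From mathcomp Require Import all_classical all_reals.
From mathcomp Require Import topology normedtype lra.

Set Implicit Arguments.
Unset Strict Implicit.
Unset Printing Implicit Defensive.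

Import Order.TTheory GRing.Theory Num.Theory.
Import numFieldNormedType.Exports.

Local Open Scope classical_set_scope.
Local Open Scope ring_scope.
Local Open Scope quotient_scope.
Local Open Scope card_scope.

(* A multiset of nonempty intervals, given by its multiplicity function. *)
Record barcode (R : realType) := Barcode {
  mult :> set R -> nat;
  mult_interval : forall J, mult J != 0%N -> J !=set0 /\ is_interval J
}.

Lemma empty_barcode_subproof (R : realType) (J : set R) :
  (fun _ : set R => 0%N) J != 0%N -> J !=set0 /\ is_interval J.
Proof. by []. Qed.

(* The choice and point structures only serve to make [get] available. *)
HB.instance Definition _ (R : realType) := gen_eqMixin (barcode R).
HB.instance Definition _ (R : realType) := gen_choiceMixin (barcode R).
HB.instance Definition _ (R : realType) :=
  isPointed.Build (barcode R) (Barcode (@empty_barcode_subproof R)).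

Definition older (R : realType) (J K : set R) :=
  exists2 t1, J t1 & forall t2, K t2 -> t1 < t2.

(* The number of intervals of [B] that contain [J] strictly.  Every barcode to
   which this is applied is finite and without repetition. *)
Definition mu (R : realType) (B : barcode R) (J : set R) : nat :=
  #|` fset_set [set K | B K != 0%N /\ J `<` K]%classic |%fset.

(* The same count, where containment is also required to be strict at the left
   endpoint. *)
Definition mu_older (R : realType) (B : barcode R) (J : set R) : nat :=
  #|` fset_set [set K | [/\ B K != 0%N, J `<` K & older K J]]%classic |%fset.

(* A functor from (R, <=) to sets. *)
Record persistent_set (R : realType) := PersistentSet {
  level :> R -> Type;
  shift : forall r t, r <= t -> level r -> level t;
  shift_id : forall r (h : r <= r) x, shift h x = x;
  shift_comp : forall r s t (rs : r <= s) (st : s <= t) (rt : r <= t) x,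
    shift st (shift rs x) = shift rt x
}.

Section Elder.
Context {R : realType} (S : persistent_set R).
Implicit Types (tau : seq R) (t : R).

Definition total_poset := {t : R & S t}.

Definition proj_total (y : total_poset) : R := tag y.

Definition preceq (x y : total_poset) :=
  exists h : tag x <= tag y, shift h (tagged x) = tagged y.

Definition chain (C : set total_poset) :=
  forall x y, C x -> C y -> preceq x y \/ preceq y x.

Definition maximal_chain (P C : set total_poset) :=
  [/\ C `<=` P, chain C &
      forall C', C' `<=` P -> chain C' -> C `<=` C' -> C' = C].

Definition oldest_chain (P : set total_poset) (y : total_poset)
    (C : set total_poset) :=
  [/\ maximal_chain P C, C y &
      forall C', maximal_chain P C' -> C' y ->
        ~ older (proj_total @` C') (proj_total @` C)].

(* Indices are shifted by one: tau_1 < ... < tau_n is the sorted sequence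
   [tau`_0; ...; tau`_n.-1]. *)
Record stratification tau : Prop := Stratification {
  strat_sorted : sorted <%R tau;
  strat_nonempty : tau != [::];
  strat_before : forall t, t < tau`_0 -> S t -> False;
  strat_constant : forall i, (i.+1 < size tau)%N ->
    exists eta : forall t, tau`_i <= t < tau`_i.+1 -> S t -> S tau`_i,
      (forall t ht, bijective (eta t ht)) /\
      (forall r t hr ht (rt : r <= t) x, eta t ht (shift rt x) = eta r hr x);
  strat_after : forall t, tau`_(size tau).-1 <= t ->
    exists x : S t, forall y, y = x;
  strat_fiber : forall i (h : tau`_i <= tau`_i.+1), (i.+1 < size tau)%N ->
    forall x : S tau`_i.+1,
      exists2 k, (k <= 2)%N & [set y | shift h y = x] #= `I_k
}.

Record morse_axioms tau : Prop := MorseAxioms {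
  morse_finite : forall t, finite_set [set: S t];
  morse_strat : stratification tau;
  morse_minimal : forall tau', stratification tau' ->
    {subset tau' <= tau} -> tau' = tau;
  morse_oldest : forall y : total_poset, exists! C, oldest_chain setT y C
}.

(* [elder_run tau P Cs]: removing the chains of [Cs] one after the other from
   [P], as the Elder Rule prescribes, exhausts [P].  The first step, where [y]
   lies over the last time, needs no separate clause. *)
Inductive elder_run tau :
    set total_poset -> seq (set total_poset) -> Prop :=
| ElderNil : elder_run tau set0 [::]
| ElderCons P y C Cs of
    P y & proj_total y \in tau &
    (forall z, P z -> proj_total z \in tau -> proj_total z <= proj_total y) &
    oldest_chain P y C & elder_run tau (P `\` C) Cs :
  elder_run tau P (C :: Cs).

End Elder.

Arguments proj_total {R S}.

Record morse_set (R : realType) := MorseSet {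
  morse_fun :> persistent_set R;
  times : seq R;
  morse_setP : morse_axioms morse_fun times
}.

(* The outcome of the Elder Rule; it does not depend on the elements chosen
   along the way. *)
Definition elder_barcode (R : realType) (S : morse_set R) : barcode R :=
  get [set B : barcode R | exists2 Cs, elder_run (times S) [set: total_poset S] Cs
    & forall J, B J = count (fun C => proj_total @` C == J) Cs].

(* A space over the real line. *)
Record rtree (R : realType) := RTree {
  space :> topologicalType;
  height : space -> R;
  height_continuous : continuous height
}.

Definition rtree_iso (R : realType) (T T' : rtree R) :=
  exists f : T -> T', exists g : T' -> T,
    [/\ cancel f g, cancel g f, continuous f, continuous g &
        forall x, height (f x) = height x].

Section Realization.
Context {R : realType} (S : persistent_set R) (tau : seq R).

Definition stratum (i : nat) : set R :=
  if (i.+1 < size tau)%N then `[tau`_i, tau`_i.+1]%classic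
  else `[tau`_i, +oo[%classic.

Definition cell_index := {classic {i : 'I_(size tau) & S tau`_i}}.

Definition cell (c : cell_index) : topologicalType := set_type (stratum (tag c)).

(* The disjoint union of the S(tau_i) x stratum i, with S(tau_i) discrete. *)
Definition cells : topologicalType := {c : cell_index & cell c}.

Definition cell_stratum (p : cells) : nat := tag (tag p).
Definition cell_elt (p : cells) : S tau`_(cell_stratum p) := tagged (tag p).
Definition cell_height (p : cells) : R := set_val (tagged p).

Definition glue (p q : cells) : Prop :=
  [/\ cell_stratum q = (cell_stratum p).+1,
      cell_height p = tau`_(cell_stratum q),
      cell_height q = tau`_(cell_stratum q) &
      exists h : tau`_(cell_stratum p) <= tau`_(cell_stratum q),
        shift h (cell_elt p) = cell_elt q].

Definition glue_equiv : rel cells :=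
  fun p q => `[< clos_refl_sym_trans cells glue p q >].

Lemma glue_equiv_refl : reflexive glue_equiv.
Proof. by move=> p; apply/asboolP; exact: rst_refl. Qed.

Lemma glue_equiv_sym : symmetric glue_equiv.
Proof. by move=> p q; apply/asboolP/asboolP; exact: rst_sym. Qed.

Lemma glue_equiv_trans : transitive glue_equiv.
Proof.
by move=> q p r /asboolP pq /asboolP qr; apply/asboolP; exact: rst_trans pq qr.
Qed.

Canonical glue_equiv_rel :=
  EquivRel glue_equiv glue_equiv_refl glue_equiv_sym glue_equiv_trans.

Definition realization_space : topologicalType :=
  quotient_topology {eq_quot glue_equiv_rel}.

Definition realization_height (x : realization_space) : R :=
  cell_height (repr x).

Lemma cell_height_equiv p q :
  clos_refl_sym_trans cells glue p q -> cell_height p = cell_height q.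
Proof.
by elim=> // [x y [_ -> ->]//|x y z _ -> _ ->].
Qed.

Lemma cell_height_continuous : continuous cell_height.
Proof.
move=> [c x]; apply: (@cvg_comp _ _ _ (existT _ c) cell_height).
  exact: existT_continuous.
exact: (@initial_continuous (cell c) R set_val x).
Qed.

Lemma realization_height_continuous : continuous realization_height.
Proof.
apply: repr_comp_continuous; first exact: cell_height_continuous.
move=> p q /eqP/eqmodP/asboolP pq; apply/eqP; exact: cell_height_equiv.
Qed.

Definition realization : rtree R := RTree realization_height_continuous.

End Realization.

Section Pi0.
Context {R : realType} (T : rtree R).
Implicit Types (A : set T) (r s t : R).

Definition joined A (x y : T) :=
  exists2 gamma : R -> T, {within `[0, 1], continuous gamma} &
    [/\ gamma 0 = x, gamma 1 = y & forall s, `[0, 1]%classic s -> A (gamma s)].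

Lemma within_reparam (h : R -> R) (gamma : R -> T) (A B : set R) :
  continuous h -> h @` B `<=` A -> {within A, continuous gamma} ->
  {within B, continuous (gamma \o h)}.
Proof.
move=> ch hBA /subspace_continuousP cg; apply/subspace_continuousP => x Bx.
have hx : h @ within B (nbhs x) `=>` within A (nbhs (h x)).
  move=> U /= wU; have : nbhs x (h @^-1` [set y | A y -> U y]) by exact: ch.
  by apply: (@filterS _ (nbhs x)) => y /= + By; apply; exact/hBA/imageP.
exact: cvg_comp hx (cg _ (hBA _ (imageP _ Bx))).
Qed.

Lemma joined_refl A x : A x -> joined A x x.
Proof.
move=> Ax; exists (cst x); last by split.
by apply: continuous_subspaceT => ?; exact: cst_continuous.
Qed.

Lemma joined_sym A x y : joined A x y -> joined A y x.
Proof.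
move=> [g cg [g0 g1 gA]].
have h01 s : `[0, 1]%classic s -> `[0 : R, 1]%classic (1 - s).
  by rewrite /= !in_itv /= => /andP[s0 s1]; rewrite subr_ge0 s1 gerBl.
exists (g \o (fun s => 1 - s)).
  apply: within_reparam cg; first last.
    by move=> _ [s s01 <-]; exact: h01.
  by move=> s; apply: cvgB; [exact: cvg_cst|exact: cvg_id].
by split=> [||s s01]; rewrite /= ?subr0 ?subrr //; exact/gA/h01.
Qed.

Lemma joined_trans A x y z : joined A x y -> joined A y z -> joined A x z.
Proof.
move=> [f cf [f0 f1 fA]] [g cg [g0 g1 gA]].
pose k (s : R) := if s <= 2^-1 then f (s * 2) else g (s * 2 - 1).
have kf s : s <= 2^-1 -> k s = f (s * 2) by rewrite /k => ->.
have kg s : 2^-1 <= s -> k s = g (s * 2 - 1).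
  rewrite /k le_eqVlt => /predU1P[<-|s2].
    by rewrite lexx mulVf ?pnatr_eq0// subrr f1 g0.
  by rewrite leNgt s2.
have h1 s : `[0, 2^-1]%classic s -> `[0 : R, 1]%classic (s * 2).
  rewrite /= !in_itv /= => /andP[s0 s1].
  by rewrite mulr_ge0//= -ler_pdivlMr// div1r.
have h2 s : `[2^-1, 1]%classic s -> `[0 : R, 1]%classic (s * 2 - 1).
  rewrite /= !in_itv /= => /andP[s0 s1].
  by lra.
have i01 : `[0 : R, 1]%classic = `[0, 2^-1] `|` `[2^-1, 1].
  apply/seteqP; split=> s /=; rewrite !in_itv /=.
    by case/andP=> -> ->; rewrite andbT /=; exact/orP/le_total.
  have hl : 2^-1 <= 1 :> R by rewrite invf_le1// ler1n.
  case=> /andP[s0 s1]; apply/andP; split=> //.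
    exact: le_trans s1 hl.
  by apply: le_trans s0; rewrite invr_ge0.
have cm : continuous (fun s : R => s * 2) by exact: mulrr_continuous.
exists k; last split.
- rewrite i01; apply: withinU_continuous; try exact: interval_closed.
    apply: (@subspace_eq_continuous _ _ _ (f \o (fun s => s * 2))).
      by move=> s; rewrite inE /= in_itv /= => /andP[_ /kf].
    by apply: within_reparam cf => // _ [s s01 <-]; exact: h1.
  apply: (@subspace_eq_continuous _ _ _ (g \o (fun s => s * 2 - 1))).
    by move=> s; rewrite inE /= in_itv /= => /andP[/kg].
  apply: within_reparam cg; last by move=> _ [s s01 <-]; exact: h2.
  by move=> s; apply: cvgB; [exact: cm|exact: cvg_cst].
- by rewrite kf ?mul0r ?invr_ge0.
- by rewrite kg ?invf_le1 ?ler1n// mul1r (_ : 2 - 1 = 1)// -[2]natr1 addrK.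
- move=> s; rewrite i01 => -[s01|s01].
    by rewrite kf; [exact/fA/h1|move: s01; rewrite /= in_itv => /andP[]].
  by rewrite kg; [exact/gA/h2|move: s01; rewrite /= in_itv => /andP[]].
Qed.

Lemma joined_sub A A' x y : A `<=` A' -> joined A x y -> joined A' x y.
Proof. by move=> AA' [g cg [g0 g1 gA]]; exists g => //; split=> // s /gA /AA'. Qed.

Definition pi0 (A : set T) : Type :=
  {C : set T | exists2 x, A x & C = joined A x}.

Lemma pi0_map_subproof A A' (AA' : A `<=` A') (C : pi0 A) :
  exists2 x, A' x &
    [set y | exists2 z, sval C z & joined A' z y] = joined A' x.
Proof.
case: C => D [x Ax DE] /=; exists x; first exact: AA'.
rewrite {D}DE; apply/seteqP; split=> y /=; last by move=> xy; exists x; [exact: joined_refl|].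
by move=> [z /(joined_sub AA') xz zy]; exact: joined_trans zy.
Qed.

Definition pi0_map A A' (AA' : A `<=` A') (C : pi0 A) : pi0 A' :=
  exist _ _ (pi0_map_subproof AA' C).

Definition sublevel t : set T := [set x | height x <= t].

Lemma sublevel_sub r t : r <= t -> sublevel r `<=` sublevel t.
Proof. by move=> rt x; rewrite /sublevel /= => /le_trans; exact. Qed.

Lemma sublevel_shift_id r (h : r <= r) C : pi0_map (sublevel_sub h) C = C.
Proof.
apply: eq_sig_hprop => [?|]; first exact: Prop_irrelevance. case: C => D [x xr DE] /=; rewrite {D}DE; apply/seteqP; split=> y /=.
  by move=> [z xz zy]; exact: joined_trans zy.
by move=> xy; exists x => //; exact: joined_refl.
Qed.

Lemma sublevel_shift_comp r s t (rs : r <= s) (st : s <= t) (rt : r <= t) C :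
  pi0_map (sublevel_sub st) (pi0_map (sublevel_sub rs) C) =
  pi0_map (sublevel_sub rt) C.
Proof.
apply: eq_sig_hprop => [?|]; first exact: Prop_irrelevance. apply/seteqP; split=> y /=.
  move=> [w [z Cz zw] wy]; exists z => //.
  by apply: joined_trans wy; exact: joined_sub (sublevel_sub st) _.
move=> [z Cz zy]; exists z => //; exists z => //; apply: joined_refl.
case: C Cz => D [x xr DE] /=; rewrite {D}DE => -[g _ [_ <- gA]].
by apply: sublevel_sub rs _ _; apply: gA; rewrite /= in_itv /= lexx ler01.
Qed.

(* The functor t |-> pi_0 (height^-1 (-oo, t]). *)
Definition sublevel_pi0 : persistent_set R :=
  PersistentSet sublevel_shift_id sublevel_shift_comp.

(* The barcode of this functor for the unique choice of times, if any, that
   turns it into a Morse set. *)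
Definition elder_map : barcode R :=
  get [set B | exists2 S : morse_set R, morse_fun S = sublevel_pi0
    & elder_barcode S = B].

End Pi0.

Section MorseTrees.
Context (R : realType).

Definition morse_tree (T : rtree R) :=
  exists S : morse_set R, rtree_iso T (realization S (times S)).

(* The set of isomorphism classes of Morse trees. *)
Definition morse_tree_class : Type :=
  {X : rtree R -> Prop | exists2 T, morse_tree T & X = rtree_iso T}.

Definition class_repr (X : morse_tree_class) : rtree R :=
  s2val (cid2 (svalP X)).

(* The library's [#=] applies to subsets of small types only, and the types of
   trees and of their classes are large. *)
Definition has_cardinal (X : Type) (P : X -> Prop) (n : nat) :=
  exists2 f : 'I_n -> X, (forall i j, f i = f j -> i = j)
    & forall x, P x <-> exists i, f i = x.

Definition Xi (X : morse_tree_class) : barcode R := elder_map (class_repr X).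

End MorseTrees.

(* Main.v *)
(* The set of components of a sublevel set of the tree built from a Morse set S
   is S(t) again, naturally in t, so isomorphism classes of Morse trees are
   isomorphism classes of Morse sets.  In a Morse set every element y has a
   least element [o y] among those flowing into it, its origin, and the chains
   that the Elder Rule removes are the fibers of o.  If the barcode is B then
   elements over t correspond to the bars containing t, and S is determined by
   the parent map p, where p j is the bar containing the element into which the
   j-th bar flows at time d j.  That bar is strictly older and dies later, so
   p j < j; conversely every such p arises from exactly one Morse set.  Counting
   the possible values of p j for each j gives the product. *)
From Stdlib Require Import Relation_Operators.
From mathcomp Require Import all_boot all_order all_algebra.
From mathcomp Require Import finmap generic_quotient.
From mathcomp Require Import all_classical all_reals.
From mathcomp Require Import topology normedtype zify.
Require Import Defs.

Set Implicit Arguments.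
Unset Strict Implicit.
Unset Printing Implicit Defensive.

Import Order.TTheory GRing.Theory Num.Theory.
Import numFieldNormedType.Exports.

Local Open Scope classical_set_scope.
Local Open Scope ring_scope.
Local Open Scope card_scope.

(** * Chains and origins *)

(** Labels in [nat] take the place of explicit isomorphisms. The bars of B are pairwise distinct, so
    an element is determined by its level and its bar. Hence labellings move along isomorphisms, two
    functors labelled over the same [p] are isomorphic, and [p] can be read off any labelled
    functor. [elder_barcode] and [elder_map] are choices with a default value: for a labelled
    functor, a run must exist and all runs must yield the same bars, and B must differ from the
    default. A tree remembers only its functor of components, whereas a realization also depends on
    times; these are therefore shown to be forced, being the births and deaths of the bars.
    Strictness of b (p j) < b j prevents ties between merging bars, which would create two oldest
    chains. *)

Section Precedence.
Context {R : realType} (S : persistent_set R).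
Implicit Types (x y z : total_poset S) (P C : set (total_poset S)).

Lemma preceq_tag x y : preceq x y -> tag x <= tag y.
Proof. by move=> []. Qed.

Lemma preceq_refl x : preceq x x.
Proof. by exists (lexx _); rewrite shift_id. Qed.

Lemma preceq_trans y x z : preceq x y -> preceq y z -> preceq x z.
Proof.
move=> [h1 e1] [h2 e2]; exists (le_trans h1 h2).
by rewrite -e2 -e1 (shift_comp h1 h2 (le_trans h1 h2)).
Qed.

Lemma preceq_eq x y : preceq x y -> tag y <= tag x -> x = y.
Proof.
case: x y => [r a] [t c] [/= h e] h'.
have rt : r = t by apply/eqP; rewrite eq_le h h'.
by subst t; rewrite -e shift_id.
Qed.

Lemma preceq_up x y z :
  preceq x y -> preceq x z -> tag y <= tag z -> preceq y z.
Proof.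
move=> [h1 e1] [h2 e2] h; exists h.
by rewrite -e1 (shift_comp h1 h h2).
Qed.

Definition upper x : set (total_poset S) := [set y | preceq x y].

Lemma upper_chain P x : chain (P `&` upper x).
Proof.
move=> y z [_ xy] [_ xz].
by case: (leP (tag y) (tag z)) => [|/ltW] h; 
  [left; exact: preceq_up xy xz h|right; exact: preceq_up xz xy h].
Qed.

End Precedence.

(* [o] sends an element to the least element of the oldest chain through it. *)
Record origin_map (R : realType) (S : persistent_set R)
    (o : total_poset S -> total_poset S) : Prop := OriginMap {
  origin_preceq : forall y, preceq (o y) y;
  origin_oldest : forall y z, preceq z y -> tag z <= tag (o y) -> z = o y
}.

Section Origin.
Context {R : realType} (S : persistent_set R).
Context (o : total_poset S -> total_poset S) (oP : origin_map o).
Implicit Types (x y z : total_poset S) (P C : set (total_poset S)).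

Lemma origin_id y : o (o y) = o y.
Proof.
have h := origin_preceq oP (o y).
exact: origin_oldest (preceq_trans h (origin_preceq oP y)) (preceq_tag h).
Qed.

Lemma origin_between y z : preceq (o y) z -> preceq z y -> o z = o y.
Proof.
move=> h1 h2; have h3 := origin_preceq oP z.
case: (leP (tag (o z)) (tag (o y))) => [|/ltW] h.
  exact: origin_oldest (preceq_trans h3 h2) h.
by apply/esym; exact: origin_oldest h.
Qed.

Lemma origin_unique o' : origin_map o' -> o' = o.
Proof.
move=> oP'; apply/funext => y.
case: (leP (tag (o' y)) (tag (o y))) => [|/ltW] h.
  exact: (origin_oldest oP) (origin_preceq oP' y) h.
exact/esym/(origin_oldest oP') /h/(origin_preceq oP y).
Qed.

(** A chain element below [o y] also flows into y, so by [origin_oldest] it is [o y]; every other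
    element comparable with [o y] lies in [upper (o y)]. *)
Lemma maximal_chain_upper P y :
  P (o y) -> maximal_chain P (P `&` upper (o y)).
Proof.
move=> Poy; split; [by move=> ? []|exact: upper_chain|].
move=> C' C'P C'ch sub; apply/seteqP; split=> [c C'c|]; last exact: sub.
split; first exact: C'P.
have [//|co] := C'ch (o y) c (sub _ (conj Poy (preceq_refl _))) C'c.
have cy := preceq_trans co (origin_preceq oP y).
by rewrite (origin_oldest oP cy (preceq_tag co)); exact: preceq_refl.
Qed.

(** A chain through y that missed [o y] would lie entirely after it, so the chain of
    [maximal_chain_upper] would be older. *)
Lemma oldest_chain_origin P y C : P y -> P (o y) ->
  oldest_chain P y C <-> C = P `&` upper (o y).
Proof.
move=> Py Poy.
have uy : (P `&` upper (o y)) y by split=> //; exact: origin_preceq.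
split=> [[[CP Cch Cmax] Cy Cold]|->].
  have Co : C (o y).
    apply: contrapT => nCo; apply: (Cold _ (maximal_chain_upper Poy) uy).
    exists (tag (o y)).
      by exists (o y) => //; split=> //; exact: preceq_refl.
    move=> _ [c Cc <-]; rewrite ltNge; apply/negP => h; apply: nCo.
    have [cy|yc] := Cch c y Cc Cy; first by rewrite -(origin_oldest oP cy h).
    have ey := preceq_eq yc (le_trans h (preceq_tag (origin_preceq oP y))).
    subst c; suff <- : y = o y by [].
    by apply: (origin_oldest oP) => //; exact: preceq_refl.
  apply/esym/Cmax; [by move=> ? []|exact: upper_chain|move=> c Cc].
  split; first exact: CP.
  have [//|co] := Cch (o y) c Co Cc.
  have cy := preceq_trans co (origin_preceq oP y).
  by rewrite (origin_oldest oP cy (preceq_tag co)); exact: preceq_refl.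
split=> //; first exact: maximal_chain_upper.
move=> C' [C'P C'ch _] C'y [t1 [c C'c <-]] lt1.
have h : tag c < tag (o y).
  apply: (lt1 (tag (o y))).
  by exists (o y) => //; split=> //; exact: preceq_refl.
have [cy|yc] := C'ch c y C'c C'y.
  by have := h; rewrite (origin_oldest oP cy (ltW h)) ltxx.
have oy := preceq_tag (origin_preceq oP y).
have := lt_le_trans (le_lt_trans (preceq_tag yc) h) oy.
by rewrite ltxx.
Qed.

Lemma unique_oldest_chain y : exists! C, oldest_chain setT y C.
Proof.
exists (setT `&` upper (o y)); split; first exact/oldest_chain_origin.
by move=> C /oldest_chain_origin ->.
Qed.

Definition lineage y : set (total_poset S) := [set z | o z = o y].

Lemma lineage_self y : lineage y y.
Proof. by []. Qed.

Lemma lineage_eq y z : lineage y z -> lineage z = lineage y.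
Proof. by rewrite /lineage /= => ->. Qed.

Lemma lineage_chain y z z' : lineage y z -> lineage y z' ->
  tag z <= tag z' -> preceq z z'.
Proof.
rewrite /lineage /= => e e'; apply: (preceq_up (x := o y)).
  by rewrite -e; exact: origin_preceq.
by rewrite -e'; exact: origin_preceq.
Qed.

Lemma lineage_start y z : lineage y z -> tag (o y) <= tag z.
Proof. by rewrite /lineage /= => <-; exact/preceq_tag/origin_preceq. Qed.

End Origin.

Section Stratified.
Context {R : realType} (S : persistent_set R) (tau : seq R).
Context (tauP : stratification S tau).

Lemma strat_lt i j : (i < j)%N -> (j < size tau)%N -> tau`_i < tau`_j.
Proof.
move=> ij js; rewrite (lt_sorted_ltn_nth 0 (strat_sorted tauP)) //.
by rewrite inE (ltn_trans ij).
Qed.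

Lemma strat_size : (0 < size tau)%N.
Proof. by rewrite lt0n size_eq0 (strat_nonempty tauP). Qed.

Lemma strat_floor t : tau`_0 <= t -> exists i,
  [/\ (i < size tau)%N, tau`_i <= t &
      forall k, (i < k)%N -> (k < size tau)%N -> t < tau`_k].
Proof.
move=> t0.
have ex : exists i, (i < size tau)%N && (tau`_i <= t).
  by exists 0%N; rewrite strat_size.
have bd i : (i < size tau)%N && (tau`_i <= t) -> (i <= size tau)%N.
  by case/andP=> /ltnW.
case: (ex_maxnP ex bd) => i /andP[is_ it] imax; exists i; split=> // k ik ks.
rewrite ltNge; apply/negP => kt; move: (imax k).
by rewrite ks kt leqNgt ik => /(_ isT).
Qed.

Lemma strat_nonempty_le t : S t -> tau`_0 <= t.
Proof.
by move=> x; rewrite leNgt; apply/negP => h; exact: (strat_before tauP h x).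
Qed.

(** The second hypothesis says that no time of [tau] lies in (r, t]. So r and t share a stratum,
    where the natural bijections to its first level turn the shift into the identity, or both lie
    beyond the last time, where levels are points. *)
Lemma strat_bij r t (h : r <= t) : tau`_0 <= r ->
  (forall u, u \in tau -> r < u -> t < u) -> bijective (@shift R S r t h).
Proof.
move=> r0 gap; have [i [is_ ir imax]] := strat_floor r0.
case: (ltnP i.+1 (size tau)) => i1.
  have r1 : r < tau`_i.+1 by exact: imax.
  have t1 : t < tau`_i.+1 by apply: gap => //; rewrite mem_nth.
  have [eta [etaB etaN]] := strat_constant tauP i1.
  have hr : tau`_i <= r < tau`_i.+1 by rewrite ir.
  have ht : tau`_i <= t < tau`_i.+1 by rewrite (le_trans ir).
  have [g gK Kg] := etaB t ht; have [g' gK' Kg'] := etaB r hr.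
  exists (g' \o eta t ht) => x /=; first by rewrite (etaN _ _ hr) gK'.
  by apply: (can_inj gK); rewrite (etaN _ _ hr) Kg'.
have ei : i = (size tau).-1 by lia.
subst i; have [x xP] := strat_after tauP ir.
have [y yP] := strat_after tauP (le_trans ir h).
by exists (fun=> x) => z; rewrite ?xP ?yP// [RHS]yP.
Qed.

Lemma strat_prev t : S t -> exists s,
  [/\ s \in tau, tau`_0 <= s, s <= t & forall u, u \in tau -> s < u -> t < u].
Proof.
move=> /strat_nonempty_le/strat_floor[i [is_ it imax]].
exists tau`_i; split=> //; first exact: mem_nth.
  case: i is_ {it imax} => // i i1; exact/ltW/strat_lt.
move=> u /(nthP 0)[k ks <-].
by rewrite (lt_sorted_ltn_nth 0 (strat_sorted tauP))// => /imax; exact.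
Qed.

Lemma strat_base t (x : S t) : exists2 s, s \in tau &
  (exists h : s <= t, exists z : S s, shift h z = x).
Proof.
have [s [st s0 h gap]] := strat_prev x; exists s => //; exists h.
by have [g gK Kg] := strat_bij h s0 gap; exists (g x).
Qed.

End Stratified.

(** * Runs of the Elder Rule *)

Section ElderRuns.
Context {R : realType} (S : persistent_set R) (tau : seq R).
Implicit Types (x y z : total_poset S) (P C : set (total_poset S)).

(* Both [upper z] and [upper w] are oldest chains through [y] when [z] and [w]
   are earliest below [y]; this is how axiom (5) yields uniqueness of origins. *)
Lemma oldest_chain_upper u y : preceq u y ->
  (forall w, preceq w y -> tag u <= tag w) -> oldest_chain setT y (upper u).
Proof.
move=> uy umin; rewrite -[upper u]setTI; split=> //.
  split; [by []|exact: upper_chain|].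
  move=> C' _ C'ch sub; apply/seteqP; split=> [c C'c|]; last exact: sub.
  split=> //; have [//|cu] := C'ch u c (sub _ (conj Logic.I (preceq_refl _))) C'c.
  have h := umin c (preceq_trans cu uy).
  by rewrite (preceq_eq cu h); exact: preceq_refl.
move=> C' [_ C'ch _] C'y [t1 [c C'c <-]] lt1.
have h : tag c < tag u.
  by apply: (lt1 (tag u)); exists u => //; split=> //; exact: preceq_refl.
have [cy|yc] := C'ch c y C'c C'y; first by rewrite ltNge umin in h.
have := lt_le_trans (le_lt_trans (preceq_tag yc) h) (preceq_tag uy).
by rewrite ltxx.
Qed.

(** Every element comes from one over a time of [tau], and [tau] is finite: the least index of such
    a time yields an earliest element below y. *)
Lemma morse_origin : morse_axioms S tau ->
  exists2 o, origin_map o & forall y, tag (o y) \in tau.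
Proof.
move=> SP; have tauP := morse_strat SP.
suff /choice[o oP] : forall y, exists e, [/\ preceq e y, tag e \in tau &
    forall w, preceq w y -> tag w <= tag e -> w = e].
  by exists o; [split=> y; case: (oP y)|move=> y; case: (oP y)].
move=> y; pose Q i := `[< (i < size tau)%N /\ exists2 z, tag z = tau`_i & preceq z y >].
have base w : preceq w y -> exists i, Q i /\ tau`_i <= tag w.
  move=> wy; have [s sin [h [z zw]]] := strat_base tauP (tagged w).
  have zw' : preceq (existT _ s z : total_poset S) w by exists h.
  case/(nthP 0): sin => i is_ es; exists i; split; last by rewrite es.
  apply/asboolP; split=> //; exists (existT _ s z) => //.
  exact: preceq_trans zw' wy.
have [i0 [Qi0 _]] := base y (preceq_refl y).
case: (ex_minnP (ex_intro Q i0 Qi0)) => i /asboolP[is_ [z ez zy]] imin.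
have zmin w : preceq w y -> tag z <= tag w.
  move=> /base[k [Qk]]; apply: le_trans; rewrite ez.
  have := imin k Qk; rewrite leq_eqVlt => /predU1P[->//|ik].
  by apply/ltW/(strat_lt tauP) => //; case/asboolP: Qk.
exists z; split=> //; first by rewrite ez mem_nth.
move=> w wy wz; have [C [_ Cuniq]] := morse_oldest SP y.
have e1 := Cuniq _ (oldest_chain_upper zy zmin).
have wmin u : preceq u y -> tag w <= tag u by move=> /zmin; exact: le_trans wz.
have e2 := Cuniq _ (oldest_chain_upper wy wmin).
apply: preceq_eq (zmin _ wy); suff : upper w z by [].
by rewrite -e2 e1; exact: preceq_refl.
Qed.

Context (tauP : stratification S tau).
Context (o : total_poset S -> total_poset S) (oP : origin_map o).
Context (otau : forall y, tag (o y) \in tau).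

(** If z in P lies above y, no time u of [tau] separates them: the point over u on the way from
    [o z] to z would belong to P and contradict the choice of y. Hence the shift from y to z is
    injective, [o z] already flows into y, and the origins agree. So the chain cut out of P is a
    full fiber of [o]. *)
Lemma run_step P y : (forall x, P x <-> P (o x)) -> P y ->
  (forall z, P z -> tag z \in tau -> tag z <= tag y) ->
  P `&` upper (o y) = lineage o y.
Proof.
move=> Psat Py ymax; apply/seteqP; split=> z; last first.
  rewrite /lineage /= => e; split; first by apply/Psat; rewrite e; exact: (Psat y).1.
  by rewrite -e; exact: origin_preceq.
move=> [Pz oyz]; have oyy := origin_preceq oP y; have ozz := origin_preceq oP z.
case: (leP (tag z) (tag y)) => [|/ltW] h.
  exact: (origin_between oP) oyz (preceq_up oyz oyy h).
have yz := preceq_up oyy oyz h.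
have ozy : tag (o z) <= tag y by exact: ymax _ ((Psat z).1 Pz) (otau z).
have gap u : u \in tau -> tag y < u -> tag z < u.
  move=> ut yu; rewrite ltNge; apply/negP => uz.
  have h1 : tag (o z) <= u by exact: le_trans ozy (ltW yu).
  pose z' : total_poset S := existT _ u (shift h1 (tagged (o z))).
  have oz' : preceq (o z) z' by exists h1.
  have z'z : preceq z' z by exact: preceq_up oz' ozz uz.
  have Pz' : P z'.
    by apply/Psat; rewrite (origin_between oP oz' z'z); exact: (Psat z).1.
  by have := ymax z' Pz' ut; rewrite leNgt yu.
have [g gK _] := strat_bij tauP h (strat_nonempty_le tauP (tagged y)) gap.
case: yz => h' e; case: ozz => h2 e2; have := e.
rewrite -e2 -(shift_comp ozy h h2) (Prop_irrelevance h' h) => /(can_inj gK) e3.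
have ozy' : preceq (o z) y by exists ozy.
case: (leP (tag (o y)) (tag (o z))) => [|/ltW] k.
  exact/esym/(origin_oldest oP).
exact: origin_oldest k.
Qed.

(** The invariant is that P is a union of fibers of [o]; removing one whole fiber preserves it,
    which keeps [run_step] applicable. *)
Lemma run_lineages P Cs : elder_run tau P Cs -> (forall x, P x <-> P (o x)) ->
  uniq Cs /\ forall C, C \in Cs <-> exists2 y, P y & C = lineage o y.
Proof.
elim=> {P Cs} [_|P y C Cs Py _ ymax + _ IH Psat].
  by split=> // C; split=> // -[].
move/(oldest_chain_origin oP _ Py ((Psat y).1 Py)); rewrite run_step// => CE.
have [|uCs CsP] := IH.
  by move=> x; rewrite CE /lineage /setD /= (origin_id oP) -(propext (Psat x)).
split=> [|D] /=.
  rewrite uCs andbT; apply/negP => /CsP[z [_ nCz] e].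
  by apply: nCz; rewrite e; exact: lineage_self.
rewrite inE; split=> [/predU1P[->|/CsP[z [Pz _] ->]]|[z Pz ->]].
- by exists y.
- by exists z.
- have [Cz|nCz] := pselect (C z).
    by rewrite CE in Cz *; rewrite (lineage_eq Cz) eqxx.
  by apply/orP; right; apply/CsP; exists z.
Qed.

End ElderRuns.

(** * Bars and parent maps *)

(** The test [j == 1] makes the first bar infinite whatever real number [d 1] is. *)
Definition bar_alive (R : realType) (d : nat -> R) (j : nat) (t : R) : bool :=
  (j == 1%N) || (t < d j).

Definition bar_valid (R : realType) N (b d : nat -> R) (t : R) (j : nat) : bool :=
  [&& (1 <= j <= N)%N, b j <= t & bar_alive d j t].

Definition bar_set (R : realType) (b d : nat -> R) (j : nat) : set R :=
  [set t | (b j <= t) && bar_alive d j t].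

Record bars (R : realType) (N : nat) (b d : nat -> R) : Prop := Bars {
  bars_gt0 : (1 <= N)%N;
  bars_lt : forall j, (2 <= j <= N)%N -> b j < d j;
  bars_root : forall j, (1 <= j <= N)%N -> b 1%N <= b j;
  bars_decr : forall j k, (2 <= j)%N -> (j < k)%N -> (k <= N)%N -> d k < d j
}.

(* [p j] is the bar that absorbs the bar [j] at time [d j]. *)
Definition parent_map (R : realType) N (b : nat -> R) (p : nat -> nat) :=
  forall j, (2 <= j <= N)%N -> [/\ (1 <= p j)%N, (p j < j)%N & b (p j) < b j].

(* The nearest ancestor of [j] that is alive at time [t]; as parents have
   smaller indices, [N] steps are enough to reach it. *)
Definition ancestor (R : realType) N (d : nat -> R) (p : nat -> nat) (t : R) j :=
  iter N (fun k => if bar_alive d k t then k else p k) j.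

Section Bars.
Context {R : realType} (N : nat) (b d : nat -> R) (bd : bars N b d).
Implicit Types (j k : nat) (r s t : R).
Local Notation alive := (bar_alive d).
Local Notation valid := (bar_valid N b d).
Local Notation bar := (bar_set b d).

Lemma alive_le j s t : s <= t -> alive j t -> alive j s.
Proof.
by rewrite /bar_alive => st /orP[->//|td]; rewrite (le_lt_trans st td) orbT.
Qed.

Lemma alive_birth j : (1 <= j <= N)%N -> alive j (b j).
Proof.
rewrite /bar_alive; case: eqP => //= j1 jN; apply: (bars_lt bd).
by lia.
Qed.

Lemma valid_birth j : (1 <= j <= N)%N -> valid (b j) j.
Proof. by move=> jN; rewrite /bar_valid jN lexx alive_birth. Qed.

Lemma bars_death_inj j k : (2 <= j <= N)%N -> (2 <= k <= N)%N ->
  d j = d k -> j = k.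
Proof.
move=> hj hk e; case: (ltngtP j k) => // jk.
  by have := bars_decr bd _ jk; rewrite e ltxx; lia.
by have := bars_decr bd _ jk; rewrite e ltxx; lia.
Qed.

(** If the bars agreed for j < k, the time [d k] would lie in bar j, which is born by [b k] and dies
    later or never, but it does not lie in bar k. *)
Lemma bar_inj j k : (1 <= j <= N)%N -> (1 <= k <= N)%N ->
  bar j = bar k -> j = k.
Proof.
wlog jk : j k / (j < k)%N => [wl|] hj hk e.
  by case: (ltngtP j k) => // jk; [exact: wl|exact/esym/wl].
have aj : alive j (d k).
  rewrite /bar_alive; case: eqP => //= j1.
  by apply: (bars_decr bd) => //; lia.
have bk : bar k (b k) by rewrite /bar_set /= lexx alive_birth.
have : bar j (b k) by rewrite e.
move=> /andP[bjk _]; have : bar j (d k).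
  rewrite /bar_set /= aj andbT (le_trans bjk)//; apply/ltW/(bars_lt bd); lia.
by rewrite e /bar_set /= /bar_alive ltxx orbF => /andP[_ /eqP]; lia.
Qed.

Context (p : nat -> nat) (pP : parent_map N b p).
Local Notation climb := (ancestor N d p).

Lemma climb_alive j t : alive j t -> climb t j = j.
Proof. by rewrite /ancestor => a; elim: N => //= n ->; rewrite a. Qed.

(** Each step through a dead bar lowers the index. At n = N the alternative k + n <= j contradicts 1
    <= k and j <= N, so the climb has reached a live bar. *)
Lemma climbS n j t : (1 <= j <= N)%N ->
  let k := iter n (fun k => if alive k t then k else p k) j in
  [/\ (1 <= k <= N)%N, alive k t \/ (k + n <= j)%N & k = j \/ b k < b j].
Proof.
move=> jN /=; elim: n => [|n [kN kn kb]].
  by split=> //; [right; rewrite addn0|left].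
rewrite iterS; move: (iter n _ j) kN kn kb => k kN kn kb.
case: ifP => [ka|/negbT nka]; first by split=> //; left.
have k2 : (2 <= k <= N)%N.
  by move: nka; rewrite /bar_alive negb_or => /andP[k1 _]; lia.
have [p1 pk pb] := pP k2; split; first by lia.
  by right; case: kn => [ka|]; [rewrite ka in nka|lia].
by right; case: kb => [<-//|]; exact: lt_trans.
Qed.

Lemma climb_range j t : (1 <= j <= N)%N -> (1 <= climb t j <= N)%N.
Proof. by move=> jN; have [] := climbS N t jN. Qed.

Lemma alive_climb j t : (1 <= j <= N)%N -> alive (climb t j) t.
Proof.
move=> jN; have [kN [//|h] _] := climbS N t jN.
by move: kN h; rewrite /ancestor; lia.
Qed.

Lemma climb_birth j t : (1 <= j <= N)%N -> climb t j = j \/ b (climb t j) < b j.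
Proof. by move=> jN; have [] := climbS N t jN. Qed.

Lemma valid_climb r t j : r <= t -> valid r j -> valid t (climb t j).
Proof.
move=> rt /and3P[jN bj _]; rewrite /bar_valid climb_range// alive_climb// andbT /=.
case: (climb_birth t jN) => [->|/ltW h]; first exact: le_trans rt.
exact: le_trans h (le_trans bj rt).
Qed.

(** A bar dead at s is dead at t, so moving to [p j] is also the first step of the climb for t; one
    more step makes no difference, as the climb has stopped after N steps. *)
Lemma climb_step s t j : s <= t -> (1 <= j <= N)%N ->
  climb t (if alive j s then j else p j) = climb t j.
Proof.
move=> st jN; case: ifPn => // nj.
have -> : p j = (if alive j t then j else p j).
  by case: ifPn => // /(alive_le st) aj; rewrite aj in nj.
rewrite /ancestor -iterSr iterS -/(climb t j) alive_climb//.
Qed.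

Lemma climb_comp s t j : s <= t -> (1 <= j <= N)%N ->
  climb t (climb s j) = climb t j.
Proof.
move=> st jN.
suff : forall n, climb t (iter n (fun k => if alive k s then k else p k) j) =
    climb t j by exact.
elim=> //= n <-; apply: climb_step => //.
by have [] := climbS n s jN.
Qed.

(** At time [d j] the bar j is dead, while its parent still lives because its index is smaller. *)
Lemma climb_death j : (2 <= j <= N)%N -> climb (d j) j = p j.
Proof.
move=> jN; have [p1 pj pb] := pP jN.
rewrite -(@climb_step (d j)) ?lexx//; last by lia.
have -> : alive j (d j) = false.
  by rewrite /bar_alive ltxx orbF; apply/negbTE/eqP; lia.
apply: climb_alive; rewrite /bar_alive; case: eqP => //= p1'.
by apply: (bars_decr bd) => //; lia.
Qed.

End Bars.

(** * Persistent sets labelled by bars *)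

Lemma card_le_II_inj T (A : set T) (f : T -> nat) n :
  {in A &, injective f} -> (forall x, A x -> (f x < n)%N) -> A #<= `I_n.
Proof.
move=> finj fn; rewrite -(card_le_eql (inj_card_eq finj)).
by apply: subset_card_le => _ [x Ax <-]; exact: fn.
Qed.

Lemma sorted_gap (R : realType) (tau : seq R) i u : sorted <%R tau ->
  (i < size tau)%N -> u \in tau -> tau`_i < u ->
  (i.+1 < size tau)%N /\ tau`_i.+1 <= u.
Proof.
move=> st is_ /(nthP 0)[k ks <-]; rewrite (lt_sorted_ltn_nth 0 st)// => ik.
have i1 := leq_ltn_trans ik ks.
by split=> //; rewrite (lt_sorted_leq_nth 0 st).
Qed.

Lemma sorted_le_last (R : realType) (tau : seq R) u : sorted <%R tau ->
  u \in tau -> u <= tau`_(size tau).-1.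
Proof.
move=> st /(nthP 0)[k ks <-].
by rewrite (lt_sorted_leq_nth 0 st) ?inE//; move: ks; case: (size tau).
Qed.

(* [lab] identifies the level of [S] over [t] with the set of bars containing
   [t], in such a way that the shift maps follow the parent map [p]. *)
Record labelled (R : realType) N (b d : nat -> R) (p : nat -> nat)
    (S : persistent_set R) (lab : forall t, S t -> nat) : Prop := Labelled {
  lab_inj : forall t, injective (lab t);
  lab_valid : forall t x, bar_valid N b d t (lab t x);
  lab_surj : forall t j, bar_valid N b d t j -> exists x, lab t x = j;
  lab_shift : forall r t (h : r <= t) x,
    lab t (shift h x) = ancestor N d p t (lab r x)
}.

Section Labelled.
Context {R : realType} (N : nat) (b d : nat -> R) (bd : bars N b d).
Context (p : nat -> nat) (pP : parent_map N b p).
Context (S : persistent_set R) (lab : forall t, S t -> nat).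
Context (labP : labelled N b d p lab).
Implicit Types (j k : nat) (r s t : R) (y z : total_poset S).
Local Notation alive := (bar_alive d).
Local Notation valid := (bar_valid N b d).
Local Notation bar := (bar_set b d).
Local Notation climb := (ancestor N d p).

Definition label y : nat := lab (tagged y).

Lemma label_range y : (1 <= label y <= N)%N.
Proof. by have /and3P[] := lab_valid labP (tagged y). Qed.

Lemma label_bar y : bar (label y) (tag y).
Proof.
by have /and3P[_ h1 h2] := lab_valid labP (tagged y); apply/andP.
Qed.

Lemma label_inj (x y : total_poset S) :
  tag x = tag y -> label x = label y -> x = y.
Proof.
case: x y => [r x] [t y] /= e; subst t; rewrite /label /= => /(lab_inj labP).
by move=> ->.
Qed.

Lemma label_preceq (x y : total_poset S) :
  preceq x y -> label y = climb (tag y) (label x).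
Proof. by rewrite /label => -[h <-]; rewrite (lab_shift labP). Qed.

Lemma preceq_label (x y : total_poset S) :
  tag x <= tag y -> label y = climb (tag y) (label x) -> preceq x y.
Proof.
by move=> h e; exists h; apply: (lab_inj labP); rewrite (lab_shift labP).
Qed.

Lemma label_exists j t : (1 <= j <= N)%N -> bar j t ->
  exists2 y, tag y = t & label y = j.
Proof.
move=> jN /andP[bj aj]; have [|x xj] := lab_surj labP (t := t) (j := j).
  by rewrite /bar_valid jN bj.
by exists (existT _ t x).
Qed.

(** The origin of y is the element with the same label over its birth. An element flowing into y
    under another label belongs to a bar born strictly later, hence lies too high to compete. *)
Lemma label_origin : exists2 o, origin_map o & forall y,
  tag (o y) = b (label y) /\ label (o y) = label y.
Proof.
suff /choice[o oP] : forall y, exists e,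
    [/\ tag e = b (label y), label e = label y, preceq e y &
      forall z, preceq z y -> tag z <= tag e -> z = e].
  by exists o => [|y]; [split=> y|]; case: (oP y).
move=> y; have yN := label_range y; have /andP[yb ya] := label_bar y.
have [|e et el] := label_exists (t := b (label y)) yN.
  by rewrite /bar_set /= lexx (alive_birth bd).
exists e; split=> //.
  by apply: preceq_label; rewrite ?et// el climb_alive.
move=> z zy; rewrite et => zb; have ly := label_preceq zy.
have /andP[bz _] := label_bar z.
have [cz|cz] := climb_birth d pP (tag y) (label_range z).
  rewrite cz in ly; apply: label_inj; last by rewrite el ly.
  by apply/eqP; rewrite et eq_le zb ly.
rewrite -ly in cz; have := lt_le_trans cz (le_trans bz zb).
by rewrite ltxx.
Qed.

Lemma label_lineage o : origin_map o ->
  forall y, lineage o y = [set z | label z = label y].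
Proof.
have [o' oP' oE] := label_origin => /(origin_unique oP') -> y.
apply/seteqP; split=> z; rewrite /lineage /= => e.
  by have [_ <-] := oE z; rewrite e; have [] := oE y.
have [tz lz] := oE z; have [ty ly] := oE y.
by apply: label_inj; rewrite ?tz ?ty ?lz ?ly e.
Qed.

Lemma image_lineage o : origin_map o -> forall y,
  proj_total @` lineage o y = bar (label y).
Proof.
move=> oP y; rewrite (label_lineage oP); apply/seteqP; split=> t /=.
  by move=> [z <- <-]; exact: label_bar.
move=> /(label_exists (label_range y))[z zt zl]; by exists z.
Qed.

Lemma labelled_finite t : finite_set [set: S t].
Proof.
apply: card_le_finite (finite_II N.+1).
apply: (card_le_II_inj (f := @lab t)); first by move=> ? ? _ _ /(lab_inj labP).
by move=> x _; have /and3P[/andP[]] := lab_valid labP x.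
Qed.

Definition critical_times : seq R :=
  sort <=%O (undup ([seq b j | j <- iota 1 N] ++ [seq d j | j <- iota 2 N.-1])).

Lemma mem_criticalP u : u \in critical_times <->
  (exists2 j, (1 <= j <= N)%N & u = b j) \/ (exists2 j, (2 <= j <= N)%N & u = d j).
Proof.
rewrite mem_sort mem_undup mem_cat; split.
  case/orP => /mapP[j]; rewrite mem_iota => jN ->; [left|right]; exists j => //; lia.
move=> [[j jN ->]|[j jN ->]]; apply/orP; [left|right]; apply: map_f;
  rewrite mem_iota; lia.
Qed.

Lemma birth_critical j : (1 <= j <= N)%N -> b j \in critical_times.
Proof. by move=> jN; apply/mem_criticalP; left; exists j. Qed.

Lemma death_critical j : (2 <= j <= N)%N -> d j \in critical_times.
Proof. by move=> jN; apply/mem_criticalP; right; exists j. Qed.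

Lemma critical_sorted : sorted <%R critical_times.
Proof. by rewrite sort_lt_sorted undup_uniq. Qed.

Local Notation tau := critical_times.

Lemma critical_size : (0 < size tau)%N.
Proof.
have : b 1%N \in tau by apply: birth_critical; rewrite (bars_gt0 bd).
by case: tau.
Qed.

Lemma valid_const i t j : (i.+1 < size tau)%N -> tau`_i <= t < tau`_i.+1 ->
  valid t j = valid tau`_i j.
Proof.
move=> i1 /andP[it ti]; have is_ := ltn_trans (ltnSn i) i1.
rewrite /bar_valid; apply: andb_id2l => jN; congr (_ && _).
  apply/idP/idP => [bt|]; last by move=> /le_trans; apply.
  rewrite leNgt; apply/negP => h.
  have [_ h2] := sorted_gap critical_sorted is_ (birth_critical jN) h.
  by have := lt_le_trans ti (le_trans h2 bt); rewrite ltxx.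
apply/idP/idP; first exact: alive_le.
rewrite /bar_alive; case: eqP => //= j1 h.
have j2 : (2 <= j <= N)%N by lia.
by have [_] := sorted_gap critical_sorted is_ (death_critical j2) h; exact: lt_le_trans.
Qed.

Lemma valid_last t j : tau`_(size tau).-1 <= t -> valid t j = (j == 1%N).
Proof.
move=> lt; have N1 := bars_gt0 bd; rewrite /bar_valid /bar_alive.
case: eqP => [->|j1]; rewrite ?orbT ?andbT /=.
  rewrite N1 /=; apply: le_trans lt; apply: sorted_le_last critical_sorted _.
  by apply: birth_critical; rewrite N1.
apply/negbTE/negP => /and3P[jN _]; rewrite ltNge (le_trans _ lt)//.
by apply: sorted_le_last critical_sorted _; apply: death_critical; lia.
Qed.

(** An element of the fiber whose label differs from that of x belongs to a bar that dies exactly at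
    this time. Deaths are distinct, so there is at most one such element, besides at most one with
    the label of x. *)
Lemma labelled_fiber i (h : tau`_i <= tau`_i.+1) (x : S tau`_i.+1) :
  (i.+1 < size tau)%N -> exists2 k, (k <= 2)%N & [set w | shift h w = x] #= `I_k.
Proof.
move=> i1; have is_ := ltn_trans (ltnSn i) i1.
have hle : [set w | shift h w = x] #<= `I_2.
  apply: (card_le_II_inj (f := fun w => nat_of_bool (lab w != lab x)));
    last by move=> y _; case: eqP.
  move=> y z; rewrite !inE /= => yx zx.
  have dies w : shift h w = x -> lab w != lab x ->
      (2 <= lab w <= N)%N /\ d (lab w) = tau`_i.+1.
    move=> wx; have := lab_shift labP h w; rewrite wx => ->.
    case/and3P: (lab_valid labP w) => wN _ wa.
    have [wa'|] := boolP (alive (lab w) tau`_i.+1); first by rewrite climb_alive ?eqxx.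
    move: wa; rewrite /bar_alive; case: eqP => //= w1 h1; rewrite -leNgt => h2 _.
    have w2 : (2 <= lab w <= N)%N by move: (lab w) wN w1 => k; lia.
    have [_ h3] := sorted_gap critical_sorted is_ (death_critical w2) h1.
    by split=> //; apply/eqP; rewrite eq_le h2.
  have [ey|ny] := eqVneq (lab y) (lab x);
    have [ez|nz] := eqVneq (lab z) (lab x) => //= _; apply: (lab_inj labP).
    by rewrite ey.
  have [yN dy] := dies _ yx ny; have [zN dz] := dies _ zx nz.
  by apply: (bars_death_inj bd); rewrite ?dy.
have /finite_setP[k kE] := card_le_finite hle (finite_II 2).
exists k => //; rewrite -(card_le_II k 2).
by rewrite -(card_le_eql kE).
Qed.

Lemma labelled_strat : stratification S tau.
Proof.
split.
- exact: critical_sorted.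
- by rewrite -size_eq0 -lt0n critical_size.
- move=> t t0 x; have /and3P[jN bj _] := lab_valid labP x.
  have := birth_critical jN => /(nthP 0)[k ks e].
  have : tau`_0 <= tau`_k.
    by rewrite (lt_sorted_leq_nth 0 critical_sorted)// inE critical_size.
  by rewrite e => h; have := le_lt_trans (le_trans h bj) t0; rewrite ltxx.
- move=> i i1.
  have ex t (ht : tau`_i <= t < tau`_i.+1) (x : S t) :
      exists y : S tau`_i, lab y = lab x.
    by apply: (lab_surj labP); rewrite -(valid_const _ i1 ht); exact: (lab_valid labP).
  exists (fun t ht x => sval (cid (ex t ht x))); split=> [t ht|r t hr ht rt x].
    have [it ti] := andP ht.
    have lk (y : S tau`_i) : lab (shift it y) = lab y.
      rewrite (lab_shift labP) climb_alive//.
      have := lab_valid labP y; rewrite -(valid_const _ i1 ht) => /and3P[_ _].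
      by [].
    exists (shift it) => [x|y]; apply: (lab_inj labP).
      by rewrite lk; case: cid.
    by case: cid => z /= ->.
  apply: (lab_inj labP); case: cid => y /= ->; case: cid => z /= ->.
  rewrite (lab_shift labP) climb_alive//.
  have := lab_valid labP x.
  by rewrite (valid_const _ i1 hr) -(valid_const _ i1 ht) => /and3P[_ _].
- move=> t lt; have [|x xl] := lab_surj labP (t := t) (j := 1%N).
    by rewrite valid_last.
  exists x => y; apply: (lab_inj labP); rewrite xl; apply/eqP.
  by rewrite -(valid_last _ lt); exact: (lab_valid labP).
- by move=> i h i1 x; exact: labelled_fiber.
Qed.

(* Birth times are forced by a failure of surjectivity of the shift map, death
   times by a failure of injectivity: [j] and [p j] meet at time [d j]. *)
Lemma critical_sub tau' : stratification S tau' -> {subset tau <= tau'}.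
Proof.
move=> sP u uc; apply: contrapT => /negP nu.
have [j jv] : exists j, valid u j.
  case/mem_criticalP: uc => -[j jN ->]; first by exists j; exact: valid_birth.
  exists (climb (d j) j); apply: (valid_climb pP (r := b j)).
    exact/ltW/(bars_lt bd).
  by apply: valid_birth => //; lia.
have [x _] := lab_surj labP jv.
have [s [st s0 su gap]] := strat_prev sP x.
have {}su : s < u.
  by rewrite lt_neqAle su andbT; apply/eqP => e; rewrite -e st in nu.
have bij r (ru : r <= u) : s <= r -> bijective (@shift R S r u ru).
  move=> sr; apply: (strat_bij sP); first exact: le_trans sr.
  by move=> v vt /(le_lt_trans sr); exact: gap.
case/mem_criticalP: uc => -[k kN ue].
  have [y yk] : exists y : S u, lab y = k.
    by apply: (lab_surj labP); rewrite ue valid_birth.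
  have [g _ Kg] := bij s (ltW su) (lexx s).
  have := lab_shift labP (ltW su) (g y); rewrite Kg yk => e.
  have /and3P[gN gb _] := lab_valid labP (g y).
  have : b k <= b (lab (g y)).
    by rewrite e; case: (climb_birth d pP u gN) => [->|/ltW].
  by move=> h; have := le_lt_trans (le_trans h gb) su; rewrite ue ltxx.
have [p1 pk pb] := pP kN.
have k1 : (1 <= k <= N)%N by lia.
have pN : (1 <= p k <= N)%N by lia.
(* Late enough for bar k and its parent to be present, and not before s, so that the shift from r to
   u is bijective; yet k and [p k] have the same image over u. *)
pose r := Num.max s (b k).
have bu : b k < u by rewrite ue; exact: bars_lt bd _ _.
have ru : r < u by rewrite gt_max su.
have br : b k <= r by rewrite le_max lexx orbT.
have [y yk] : exists y : S r, lab y = k.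
  by apply: (lab_surj labP); rewrite /bar_valid k1 br /bar_alive -ue ru orbT.
have apu : alive (p k) u.
  rewrite /bar_alive; case: eqP => //= pk1; rewrite ue.
  by apply: (bars_decr bd) => //; lia.
have [z zk] : exists z : S r, lab z = p k.
  apply: (lab_surj labP); rewrite /bar_valid pN (le_trans (ltW pb) br).
  by rewrite (alive_le (ltW ru) apu).
have [|g gK _] := bij r (ltW ru); first by rewrite le_max lexx.
have yz : y = z.
  apply: (can_inj gK); apply: (lab_inj labP); rewrite !(lab_shift labP) yk zk.
  by rewrite (climb_alive N p apu) ue (climb_death bd pP).
by move: pk; rewrite -zk -yz yk ltnn.
Qed.

Lemma labelled_times tau' : morse_axioms S tau' -> tau' = tau.
Proof.
move=> SP; apply/esym/(morse_minimal SP); first exact: labelled_strat.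
exact/critical_sub/morse_strat.
Qed.

Lemma labelled_morse : morse_axioms S tau.
Proof.
split.
- exact: labelled_finite.
- exact: labelled_strat.
- move=> tau' sP sub; apply: lt_sorted_eq (strat_sorted sP) critical_sorted _.
  by move=> u; apply/idP/idP => [/sub|/(critical_sub sP)].
- by move=> y; have [o oP _] := label_origin; exact: unique_oldest_chain oP y.
Qed.

End Labelled.

(** * The barcode of a labelled persistent set *)

Lemma barcode_ext (R : realType) (B B' : barcode R) :
  (forall J, B J = B' J) -> B = B'.
Proof.
case: B B' => [f fP] [g gP] /= /funext fg; subst g.
by congr Barcode; exact: Prop_irrelevance.
Qed.

Lemma seq_max_ex (R : realType) (s : seq R) (P : R -> Prop) :
  (exists2 u, u \in s & P u) ->
  exists u, [/\ u \in s, P u & forall v, v \in s -> P v -> v <= u].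
Proof.
move=> [u us Pu]; pose s' := [seq v <- s | `[< P v >]].
have us' : u \in s' by rewrite mem_filter us andbT; exact/asboolP.
have [w [ws' wmax]] : exists w, w \in s' /\ forall v, v \in s' -> v <= w.
  elim: s' {us us'} (ex_intro (fun u => u \in s') u us') => [[]//|v l IH _].
  case: l IH => [_|v' l IH].
    by exists v; split=> [|v']; rewrite inE// => /eqP ->.
  have [|w [wl wmax]] := IH; first by exists v'; rewrite mem_head.
  case: (leP v w) => vw.
    exists w; split; first by rewrite inE wl orbT.
    by move=> v''; rewrite inE => /predU1P[->//|/wmax].
  exists v; split; first by rewrite mem_head.
  by move=> v''; rewrite inE => /predU1P[->//|/wmax/le_trans]; apply; exact: ltW.
move: ws'; rewrite mem_filter => /andP[/asboolP Pw ws].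
exists w; split=> // v vs Pv; apply: wmax.
by rewrite mem_filter vs andbT; exact/asboolP.
Qed.

Section BarcodeOfLabelled.
Context {R : realType} (N : nat) (b d : nat -> R) (bd : bars N b d).
Local Notation bar := (bar_set b d).

Definition bar_seq := [seq bar j | j <- iota 1 N].

Lemma bar_seqP J : reflect (exists2 j, (1 <= j <= N)%N & J = bar j) (J \in bar_seq).
Proof.
apply: (iffP mapP) => -[j jN ->]; exists j => //; move: jN; rewrite mem_iota; lia.
Qed.

Lemma uniq_bar_seq : uniq bar_seq.
Proof.
rewrite map_inj_in_uniq ?iota_uniq// => j k; rewrite !mem_iota => hj hk.
by apply: (bar_inj bd); lia.
Qed.

Section Labelled.
Context (p : nat -> nat) (pP : parent_map N b p).
Context (S : persistent_set R) (lab : forall t, S t -> nat).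
Context (labP : labelled N b d p lab) (tau : seq R) (SP : morse_axioms S tau).
Local Notation label := (label lab).

Lemma labelled_origin_times : exists2 o, origin_map o &
  forall y : total_poset S, tag (o y) \in tau.
Proof.
have [o oP oE] := label_origin bd pP labP; exists o => // y.
have [-> _] := oE y; rewrite (labelled_times bd pP labP SP).
by apply: birth_critical; exact: label_range labP _.
Qed.

(** Passing from all labels to a set L lets the induction remove one lineage, hence one label, at a
    time. *)
Lemma labelled_run (L : seq nat) : uniq L -> (forall j, j \in L -> (1 <= j <= N)%N) ->
  exists Cs, elder_run tau [set y : total_poset S | label y \in L] Cs.
Proof.
have [o oP otau] := labelled_origin_times.
have oL y : label (o y) = label y.
  have : lineage o y (o y) by exact: origin_id.
  by rewrite (label_lineage bd pP labP oP).
have [n] := ubnP (size L); elim: n L => [//|n IH] L; rewrite ltnS => sL uL LN.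
have [->|[j jL]] : L = [::] \/ exists j, j \in L.
    by case: (L) => [|j l]; [left|right; exists j; rewrite mem_head].
  exists [::]; rewrite (_ : [set _ | _] = set0); first exact: ElderNil.
  by apply/seteqP; split.
pose P := [set y : total_poset S | label y \in L].
have Psat y : P y <-> P (o y) by rewrite /P /= oL.
have [y0 Py0] : exists y0, P y0.
  have [|y _ yj] := label_exists labP (t := b j) (LN j jL);
    last by exists y; rewrite /P /= yj.
  by rewrite /bar_set /= lexx (alive_birth bd (LN j jL)).
have [|u [ut [y [Py yu]] umax]] :=
    @seq_max_ex R tau (fun u => exists y, P y /\ tag y = u).
  exists (tag (o y0)); first exact: otau.
  by exists (o y0); split=> //; exact: (Psat y0).1.
have ymax z : P z -> tag z \in tau -> tag z <= tag y.
  by move=> Pz zt; rewrite yu; apply: umax => //; exists z.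
have CE := run_step (morse_strat SP) oP otau Psat Py ymax.
have [Cs run] : exists Cs, elder_run tau [set z | label z \in rem (label y) L] Cs.
  apply: IH; [|exact: rem_uniq|by move=> k /mem_rem; exact: LN].
  by rewrite size_rem//; move: sL jL; case: (L).
exists (lineage o y :: Cs); apply: (ElderCons Py) => //.
  by rewrite /proj_total yu.
  by apply/(oldest_chain_origin oP) => //; exact: (Psat y).1.
rewrite (_ : P `\` _ = [set z | label z \in rem (label y) L])//.
rewrite (label_lineage bd pP labP oP); apply/seteqP; split=> z /=.
  by move=> [zL /eqP zy]; rewrite mem_rem_uniq// inE zy.
by rewrite mem_rem_uniq// inE => /andP[/eqP zy zL].
Qed.

Lemma labelled_run_bars Cs : elder_run tau [set: total_poset S] Cs ->
  perm_eq [seq proj_total @` C | C <- Cs] bar_seq.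
Proof.
have [o oP otau] := labelled_origin_times.
move=> /(run_lineages (morse_strat SP) oP otau)[|uCs CsP]; first by [].
apply: uniq_perm; [|exact: uniq_bar_seq|].
  rewrite map_inj_in_uniq// => _ _ /CsP[y _ ->] /CsP[z _ ->].
  rewrite !(image_lineage bd pP labP oP) => /(bar_inj bd) e.
  by rewrite !(label_lineage bd pP labP oP) e//; exact: label_range labP _.
move=> J; apply/mapP/bar_seqP => [[_ /CsP[y _ ->] ->]|[j jN ->]].
  exists (label y); first exact: label_range labP _.
  by rewrite (image_lineage bd pP labP oP).
have [|y _ yj] := label_exists labP (t := b j) jN.
  by rewrite /bar_set /= lexx (alive_birth bd jN).
exists (lineage o y); first by apply/CsP; exists y.
by rewrite (image_lineage bd pP labP oP) yj.
Qed.

End Labelled.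

Context (B : barcode R) (BE : forall J, B J = count_mem J bar_seq).

(** [elder_barcode] is a choice: [labelled_run] shows that a value exists, [labelled_run_bars] that
    B is the only one. *)
Lemma elder_labelled (p : nat -> nat) (S : morse_set R)
    (lab : forall t, morse_fun S t -> nat) : parent_map N b p ->
  labelled N b d p lab -> elder_barcode S = B.
Proof.
move=> pP labP; apply: xget_unique => [|B' [Cs run B'E]].
  have [||Cs run] := @labelled_run p pP S lab labP (times S) (morse_setP S) (iota 1 N).
  - exact: iota_uniq.
  - by move=> j; rewrite mem_iota; lia.
  have runT : elder_run (times S) [set: total_poset S] Cs.
    rewrite (_ : [set: _] = [set y : total_poset S | label lab y \in iota 1 N])//.
    apply/seteqP; split=> // y _ /=; rewrite mem_iota.
    by have := label_range labP y; lia.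
  have permE := labelled_run_bars pP labP (morse_setP S) runT.
  by exists Cs => // J; rewrite BE -(permP permE) count_map.
apply: barcode_ext => J; rewrite B'E BE.
by rewrite -(permP (labelled_run_bars pP labP (morse_setP S) run)) count_map.
Qed.

End BarcodeOfLabelled.

(** * Labels from the Elder Rule *)

Lemma uniq_map_inj (T U : eqType) (f : T -> U) (s : seq T) :
  uniq (map f s) -> {in s &, injective f}.
Proof.
elim: s => //= z s IH /andP[nz us] x y; rewrite !inE.
case/predU1P => [->|xs] /predU1P[->|ys] e //; last exact: IH.
  by case/mapP: nz; exists y.
by case/mapP: nz; exists x.
Qed.

Section LabelsOfMorse.
Context {R : realType} (N : nat) (b d : nat -> R) (bd : bars N b d).
Context (S : persistent_set R) (tau : seq R).
Context (SP : morse_axioms S tau).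
Implicit Types (x y z : total_poset S) (j k : nat).
Local Notation bar := (bar_set b d).

(** Since the bars are pairwise distinct, the projection of a lineage determines it, and the index
    of that bar serves as the label L. *)
Lemma labels_of_run Cs : elder_run tau [set: total_poset S] Cs ->
  (forall J, count (fun C => proj_total @` C == J) Cs = count_mem J (bar_seq N b d)) ->
  exists p lab, parent_map N b p /\ @labelled R N b d p S lab.
Proof.
move=> run runE; have [o oP otau] := morse_origin SP.
have [|uCs CsP] := run_lineages (morse_strat SP) oP otau run; first by [].
have permE : perm_eq [seq proj_total @` C | C <- Cs] (bar_seq N b d).
  by apply/allP => J _ /=; rewrite count_map; apply/eqP/runE.
have projI : {in Cs &, injective (fun C => proj_total @` C)}.
  by apply: uniq_map_inj; rewrite (perm_uniq permE) (uniq_bar_seq bd).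
have linC y : lineage o y \in Cs by apply/CsP; exists y.
have /choice[L LP] : forall y, exists j,
    (1 <= j <= N)%N /\ proj_total @` lineage o y = bar j.
  move=> y; have : proj_total @` lineage o y \in bar_seq N b d.
    rewrite -(perm_mem permE).
    exact: (map_f (fun C => proj_total @` C) (linC y)).
  by move=> /bar_seqP[j jN e]; exists j.
have LN y : (1 <= L y <= N)%N by have [] := LP y.
have Llin y z : o y = o z -> L y = L z.
  move=> e; apply: (bar_inj bd) => //.
  by have [_ <-] := LP y; have [_ <-] := LP z; rewrite /lineage e.
have linL y z : L y = L z -> lineage o y = lineage o z.
  move=> e; apply: projI => //.
  by have [_ ->] := LP y; have [_ ->] := LP z; rewrite e.
have Lbar y : bar (L y) (tag y) by have [_ <-] := LP y; exists y.
have Lex j t : (1 <= j <= N)%N -> bar j t -> exists2 z, tag z = t & L z = j.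
  move=> jN jt; have : bar j \in bar_seq N b d by apply/bar_seqP; exists j.
  rewrite -(perm_mem permE) => /mapP[_ /CsP[y _ ->] e].
  have [jy ey] := LP y; have Ly : L y = j by apply: (bar_inj bd); rewrite -?ey.
  have : (proj_total @` lineage o y) t by rewrite -e.
  by move=> [z yz <-]; exists z => //; rewrite -Ly; exact: Llin.
have Lstart y : tag (o y) = b (L y).
  have /andP[h _] : bar (L y) (tag (o y)).
    by have [_ <-] := LP y; exists (o y) => //; exact: origin_id.
  have : bar (L y) (b (L y)) by rewrite /bar_set /= lexx (alive_birth bd).
  have [_ <-] := LP y; move=> [z yz zt].
  apply/eqP; rewrite eq_le h andbT -zt; exact: lineage_start yz.
have Lchain y z : tag y <= tag z -> L y = L z -> preceq y z.
  move=> tyz /linL e; apply: (lineage_chain oP (y := y)) tyz => //.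
  by rewrite e; exact: lineage_self.
(* Over [tag y] the bar of x has an element z, which lies above x; only one element at that level
   does, so y = z. *)
have Lstay x y : preceq x y -> bar (L x) (tag y) -> L y = L x.
  move=> xy /(Lex _ _ (LN x))[z zt zL].
  have xz : preceq x z by apply: Lchain; rewrite // zt; exact: preceq_tag.
  rewrite -zL; congr L; apply: preceq_eq; rewrite ?zt//.
  by apply: preceq_up xy xz _; rewrite zt.
(* The witness for j is the label of w, the image over [d j] of the first element e of bar j;
   outside 2 <= j <= N it is the dummy 0. *)
have /choice[p pP] : forall j, exists k, (2 <= j <= N)%N ->
    [/\ (1 <= k)%N, (k < j)%N, b k < b j &
        forall x y, L x = j -> preceq x y -> tag y = d j -> L y = k].
  move=> j; have [jN|] := boolP (2 <= j <= N)%N; last by exists 0%N.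
  have jN1 : (1 <= j <= N)%N by lia.
  have bdj := bars_lt bd jN.
  have [|e et eL] := Lex j (b j) jN1.
    by rewrite /bar_set /= lexx (alive_birth bd).
  have h : tag e <= d j by rewrite et ltW.
  pose w : total_poset S := existT _ (d j) (shift h (tagged e)).
  have ew : preceq e w by exists h.
  exists (L w) => _; have wN := LN w; have /andP[bw aw] := Lbar w.
  (* Seniority enters here: otherwise e would be no later than the origin of w, hence be that
     origin, and w would carry the label j although bar j has ended at [d j]. *)
  have bwj : b (L w) < b j.
    rewrite ltNge; apply/negP => bjw.
    have eo : e = o w by apply: (origin_oldest oP) ew _; rewrite et Lstart.
    have : L e = L w by apply: Llin; rewrite eo; exact: origin_id oP w.
    rewrite eL => jw; have := Lbar w; rewrite -jw /bar_set /= /bar_alive ltxx orbF.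
    by case/andP => _; lia.
  split=> //; first by case/andP: wN.
    move: aw; rewrite /bar_alive => /predU1P[->|]; first by case/andP: jN.
    rewrite ltNge; apply: contraNT; rewrite -leqNgt leq_eqVlt.
    case/predU1P => [<-//|jw]; apply/ltW/(bars_decr bd) => //; [by case/andP: jN|].
    by case/andP: wN.
  move=> x y xL xy yt; congr L.
  have /andP[bx _] := Lbar x; rewrite xL in bx.
  have ex : preceq e x by apply: Lchain; rewrite ?et ?eL.
  have ey := preceq_trans ex xy.
  by apply: preceq_eq; rewrite /= ?yt//; apply: preceq_up ey ew _; rewrite yt.
have ppar : parent_map N b p by move=> j jN; have [] := pP j jN.
exists p, (fun t (u : S t) => L (existT _ t u)); split=> //; split.
- move=> t u v e; have [h] := Lchain (existT _ t u) (existT _ t v) (lexx t) e.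
  by rewrite shift_id.
- move=> t u; have := Lbar (existT _ t u); rewrite /bar_valid LN /bar_set /=.
  by [].
- move=> t j /and3P[jN bj aj]; have [|[r z] /= zt zL] := Lex j t jN.
    by rewrite /bar_set /= bj.
  by subst r; exists z.
(* Induction on the label of x: if its bar is dead over [tag y], the flow is cut at the death time,
   where the label drops to that of the parent. *)
suff Lshift : forall n x y, (L x < n)%N -> preceq x y ->
    L y = ancestor N d p (tag y) (L x).
  move=> r t h x; set x' := existT _ r x : total_poset S.
  by apply: (Lshift (L x').+1 x' (existT _ t (shift h x))) => //; exists h.
elim=> // n IH x y; rewrite ltnS => Ln xy.
have [a|na] := boolP (bar_alive d (L x) (tag y)).
  rewrite climb_alive//; apply: Lstay => //; rewrite /bar_set /= a andbT.
  by have /andP[h _] := Lbar x; exact: le_trans h (preceq_tag xy).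
have xN := LN x; have /andP[bx ax] := Lbar x.
have [x1 dy] : (L x != 1)%N /\ d (L x) <= tag y.
  by move: na; rewrite /bar_alive negb_or -leNgt => /andP.
have x2 : (2 <= L x <= N)%N by move: (L x) xN x1 => k; lia.
have [_ pL _ pE] := pP _ x2.
have dx : tag x <= d (L x).
  by move: ax; rewrite /bar_alive (negbTE x1) /= => /ltW.
pose w : total_poset S := existT _ (d (L x)) (shift dx (tagged x)).
have xw : preceq x w by exists dx.
have wy : preceq w y := preceq_up xw xy dy.
have Lw : L w = p (L x) by exact: pE xw _.
rewrite (IH w y)//; last by rewrite Lw; exact: leq_trans Ln.
rewrite Lw -(climb_step d ppar (lexx (tag y)) xN).
by rewrite (negbTE na).
Qed.

End LabelsOfMorse.

Section MorseLabels.
Context {R : realType} (N : nat) (b d : nat -> R) (bd : bars N b d).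
Context (B : barcode R) (BE : forall J, B J = count_mem J (bar_seq N b d)).

(** The default value of [get] is the empty barcode; excluding it makes [elder_barcode S = B] yield
    an actual run. *)
Lemma barcode_neq_point : B <> point.
Proof.
move=> /(congr1 (fun B : barcode R => B (bar_set b d 1))); rewrite BE.
suff : bar_set b d 1 \in bar_seq N b d by rewrite -has_pred1 has_count => /[swap] ->.
by apply/bar_seqP; exists 1%N => //; rewrite (bars_gt0 bd).
Qed.

Lemma morse_labels (S : morse_set R) : elder_barcode S = B ->
  exists p lab, parent_map N b p /\ @labelled R N b d p S lab.
Proof.
rewrite /elder_barcode; case: xgetP => [B' _ [Cs run CsE] eB|_ eB]; last first.
  by case: barcode_neq_point.
by apply: (labels_of_run bd (morse_setP S) run) => J; rewrite -CsE eB BE.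
Qed.

End MorseLabels.

(** * Components of sublevel sets of a realization *)

Section RealizationValues.
Local Open Scope quotient_scope.
Context {R : realType} (S : persistent_set R) (tau : seq R).
Implicit Types (p q : cells S tau) (t : R).

Definition to_real p : realization S tau :=
  \pi_(quotient_topology {eq_quot glue_equiv_rel S tau}) p.

Lemma to_real_continuous : continuous to_real.
Proof. exact: pi_continuous. Qed.

Lemma to_realP p q : to_real p = to_real q <->
  clos_refl_sym_trans _ (@glue R S tau) p q.
Proof.
rewrite /to_real; split=> [/eqmodP/asboolP//|h].
by apply/eqmodP/asboolP.
Qed.

Lemma to_realK (z : realization S tau) : to_real (repr z) = z.
Proof. exact: reprK. Qed.

Lemma height_to_real p : height (to_real p) = cell_height p.
Proof.
apply: cell_height_equiv; apply/to_realP; exact: to_realK.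
Qed.

Lemma stratum_ge i u : stratum tau i u -> tau`_i <= u.
Proof. by rewrite /stratum; case: ifP => _ /=; rewrite in_itv /= => /andP[]. Qed.

Lemma cell_base p : tau`_(cell_stratum p) <= cell_height p.
Proof. by apply: stratum_ge; exact: set_valP. Qed.

(** The component of a point in the sublevel set over t is tracked by flowing to t the element that
    indexes its cell. *)
Definition cell_val t p (h : cell_height p <= t) : S t :=
  shift (le_trans (cell_base p) h) (cell_elt p).

Lemma cell_val_glue t p q (hp : cell_height p <= t) (hq : cell_height q <= t) :
  to_real p = to_real q -> cell_val hp = cell_val hq.
Proof.
move=> /to_realP pq; elim: pq hp hq => {p q}
  [p q [_ _ _ [h e]]|p|p q pq IH|p q r pq IH1 _ IH2] hp hq.
- by rewrite /cell_val -e (shift_comp h _ (le_trans (cell_base p) hp)).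
- by rewrite (Prop_irrelevance hp hq).
- by rewrite (IH hq hp).
- have h : cell_height q <= t by rewrite -(cell_height_equiv pq).
  by rewrite (IH1 hp h) (IH2 h hq).
Qed.

Definition val_at t (z : realization S tau) (h : height z <= t) : S t :=
  @cell_val t (repr z) h.

Lemma val_at_to_real t p (h : height (to_real p) <= t) (h' : cell_height p <= t) :
  val_at h = cell_val h'.
Proof. by apply: cell_val_glue; rewrite to_realK. Qed.

Lemma shift_val_at r t (rt : r <= t) (z : realization S tau)
    (h : height z <= r) (h' : height z <= t) :
  shift rt (val_at h) = val_at h'.
Proof. by rewrite /val_at /cell_val; exact: shift_comp. Qed.

Definition cell_pt (c : cell_index S tau) (s : cell c) : cells S tau := existT _ c s.

(** Points above t satisfy the condition vacuously, which makes the set open in the whole tree: its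
    trace on a cell is either the entire cell or the part above t. *)
Lemma open_val_at t (Q : S t -> Prop) :
  open [set z : realization S tau | forall h : height z <= t, Q (val_at h)].
Proof.
suff : open (to_real @^-1` [set z | forall h : height z <= t, Q (val_at h)]) by [].
apply/sigT_openP => c.
have vE (s : cell c) (h : cell_height (cell_pt s) <= t)
    (h' : height (to_real (cell_pt s)) <= t) (hb : tau`_(tag c) <= t) :
    val_at h' = shift hb (tagged c).
  rewrite (val_at_to_real h' h) /cell_val.
  by rewrite (Prop_irrelevance (le_trans _ _) hb).
have [[hb nQ]|all] :=
    pselect (exists hb : tau`_(tag c) <= t, ~ Q (shift hb (tagged c))).
  rewrite (_ : _ @^-1` _ =
      (@set_val _ (stratum tau (tag c))) @^-1` [set u | t < u]).
    apply: open_comp; last exact: open_gt.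
    by move=> s _; exact: (@initial_continuous (cell c) R set_val s).
  apply/seteqP; split=> s /=.
    move=> H; rewrite ltNge; apply/negP => h; apply: nQ.
    have h' : height (to_real (cell_pt s)) <= t by rewrite height_to_real.
    by rewrite -(vE s h h' hb).
  move=> ts h'; have : height (to_real (cell_pt s)) <= t by exact: h'.
  by rewrite height_to_real leNgt ts.
rewrite (_ : _ @^-1` _ = setT); first exact: openT.
apply/seteqP; split=> // s _ h' /=.
have h : cell_height (cell_pt s) <= t by rewrite -height_to_real.
have hb := le_trans (cell_base _) h.
rewrite (vE s h h' hb); apply: contrapT => nQ; apply: all.
by exists hb.
Qed.

(* The value is constant on each cell, hence locally constant on the sublevel
   set, and a path cannot change it. *)
Lemma joined_val_at t (x y : realization S tau) (hx : height x <= t)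
    (hy : height y <= t) :
  joined (sublevel t) x y -> val_at hx = val_at hy.
Proof.
move=> [g cg [g0 g1 gt]].
pose E := g @` `[0, 1]%classic.
have Ec : connected E.
  by apply: connected_continuous_connected cg; exact: segment_connected.
pose U (Q : S t -> Prop) :=
  [set z : realization S tau | forall h : height z <= t, Q (val_at h)].
have Et z : E z -> height z <= t by move=> [s s01 <-]; exact: gt.
have EU := Ec (E `&` U (eq (val_at hx))); have {EU} : E `&` U (eq (val_at hx)) = E.
  apply: EU.
  - exists x; split; last by move=> h /=; rewrite (Prop_irrelevance h hx).
    by exists 0 => //; rewrite /= in_itv /= lexx ler01.
  - by exists (U (eq (val_at hx))) => //; exact: open_val_at.
  (* Within E the points with the given value also form the trace of a closed set, since having a
     different value is an open condition. *)
  exists (~` U (fun v => val_at hx <> v)); first exact/open_closedC/open_val_at.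
  apply/seteqP; split=> z [Ez Uz]; split=> //.
    by move=> /(_ (Et z Ez)); apply; exact: Uz.
  move=> h; apply: contrapT => ne; apply: Uz => h'.
  by rewrite (Prop_irrelevance h' h).
move/seteqP => [_ /(_ y)]; case=> [|_ /(_ hy)//].
by exists 1 => //; rewrite /= in_itv /= lexx ler01.
Qed.

End RealizationValues.

Definition persistent_iso (R : realType) (S S' : persistent_set R) :=
  exists f : forall t, S t -> S' t, exists g : forall t, S' t -> S t,
    [/\ forall t, cancel (f t) (g t), forall t, cancel (g t) (f t) &
        forall r t (h : r <= t) x, f t (shift h x) = shift h (f r x)].

Lemma persistent_iso_sym (R : realType) (S S' : persistent_set R) :
  persistent_iso S S' -> persistent_iso S' S.
Proof.
move=> [f [g [fK gK fN]]]; exists g, f; split=> // r t h x.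
by apply: (can_inj (fK t)); rewrite fN !gK.
Qed.

Lemma persistent_iso_bij (R : realType) (S S' : persistent_set R)
    (f : forall t, S t -> S' t) :
  (forall t, injective (f t)) -> (forall t y, exists x, f t x = y) ->
  (forall r t (h : r <= t) x, f t (shift h x) = shift h (f r x)) ->
  persistent_iso S S'.
Proof.
move=> fI fS fN; exists f, (fun t y => sval (cid (fS t y))); split=> //.
  by move=> t x; apply: fI; case: cid.
by move=> t y; case: cid.
Qed.

Lemma rtree_iso_refl (R : realType) (T : rtree R) : rtree_iso T T.
Proof. by exists id, id; split=> // x; exact: cvg_id. Qed.

Lemma rtree_iso_sym (R : realType) (T T' : rtree R) :
  rtree_iso T T' -> rtree_iso T' T.
Proof.
move=> [f [g [fK gK fc gc fh]]]; exists g, f; split=> // x.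
by rewrite -fh gK.
Qed.

Lemma rtree_iso_trans (R : realType) (T T' T'' : rtree R) :
  rtree_iso T T' -> rtree_iso T' T'' -> rtree_iso T T''.
Proof.
move=> [f [g [fK gK fc gc fh]]] [f' [g' [fK' gK' fc' gc' fh']]].
exists (f' \o f), (g \o g'); split.
- by move=> x /=; rewrite fK' fK.
- by move=> x /=; rewrite gK gK'.
- by move=> x; apply: continuous_comp; [exact: fc|exact: fc'].
- by move=> x; apply: continuous_comp; [exact: gc'|exact: gc].
- by move=> x /=; rewrite fh' fh.
Qed.

Lemma joined_image (R : realType) (T T' : rtree R) (f : T -> T') t x y :
  continuous f -> (forall z, height (f z) = height z) ->
  joined (sublevel t) x y -> joined (sublevel t) (f x) (f y).
Proof.
move=> fc fh [g cg [g0 g1 gt]]; exists (f \o g).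
  move/subspace_continuousP: cg => cg; apply/subspace_continuousP => s s01.
  exact: cvg_comp (cg s s01) (fc _).
by split=> [||s /gt]; rewrite /= ?g0 ?g1// /sublevel /= fh.
Qed.

Section Paths.
Context {R : realType} (S : persistent_set R) (tau : seq R).
Context (tauP : stratification S tau).
Implicit Types (p q : cells S tau) (t : R).

Lemma stratum_base i : (i < size tau)%N -> stratum tau i tau`_i.
Proof.
move=> is_; rewrite /stratum; case: ifPn => i1 /=; rewrite in_itv /= lexx//=.
exact/ltW/(strat_lt tauP).
Qed.

Lemma stratum_interval i : is_interval (stratum tau i).
Proof. by rewrite /stratum; case: ifP => _; exact: interval_is_interval. Qed.

Lemma joined_cell (c : cell_index S tau) (u v : cell c) t :
  set_val u <= set_val v -> set_val v <= t ->
  joined (sublevel t) (to_real (cell_pt u)) (to_real (cell_pt v)).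
Proof.
move=> uv vt; pose D := stratum tau (tag c).
pose l (s : R) := set_val u + s * (set_val v - set_val u).
(* A path is defined on all of R and [cell] is a subset type: clamping to [u, v] keeps every value
   in the stratum. *)
pose g (s : R) := Num.max (set_val u) (Num.min (set_val v) (l s)).
have gu s : set_val u <= g s by rewrite /g le_max lexx.
have gv s : g s <= set_val v by rewrite /g ge_max uv ge_min lexx.
have gD s : g s \in D.
  apply/mem_set/(@stratum_interval (tag c) (set_val u) (set_val v));
    by [exact: set_valP|rewrite gu gv].
pose G s : cell c := exist _ (g s) (gD s).
have GE s : set_val (G s) = g s by [].
have g_cont : continuous g.
  move=> s; apply: (@continuous_max R R (fun=> set_val u) ((fun=> set_val v) \min l)).
    exact: cvg_cst.
  apply: (@continuous_min R R (fun=> set_val v) l); first exact: cvg_cst.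
  by apply: cvgD; [exact: cvg_cst|apply: cvgM; [exact: cvg_id|exact: cvg_cst]].
have G_cont : continuous G.
  apply/continuousP => _ [A oA <-]; rewrite -comp_preimage.
  by move/continuousP: g_cont; exact.
exists (fun s => to_real (cell_pt (G s))).
  apply: continuous_subspaceT => s.
  apply: (@continuous_comp _ _ _ (fun s => cell_pt (G s)) (@to_real R S tau));
    last exact: to_real_continuous.
  apply: continuous_comp; first exact: G_cont.
  exact: existT_continuous.
split=> [||s _].
- congr (to_real (cell_pt _)); apply: val_inj => /=.
  by rewrite /g /l mul0r addr0 min_r// maxxx.
- congr (to_real (cell_pt _)); apply: val_inj => /=.
  by rewrite /g /l mul1r addrC subrK minxx max_r.
- suff : height (to_real (cell_pt (G s))) <= t by [].
  by rewrite height_to_real; exact: le_trans (gv s) vt.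
Qed.

Definition base_pt (k : 'I_(size tau)) (a : S tau`_k) : cells S tau :=
  @cell_pt R S tau (existT _ k a)
    (exist _ tau`_k (mem_set (stratum_base (ltn_ord k)))).

(** Induction on the number n of strata to cross: climb to the top of the cell, where the gluing
    passes to the base of the next one. *)
Lemma joined_base n t (i k : 'I_(size tau)) (a : S tau`_i)
    (u : cell (existT _ i a : cell_index S tau)) (h : tau`_i <= tau`_k) :
  k = (i + n)%N :> nat -> tau`_k <= t -> set_val u <= t ->
  joined (sublevel t) (to_real (cell_pt u)) (to_real (base_pt (shift h a))).
Proof.
elim: n i a u h => [|n IH] i a u h kE kt ut.
  have ki : k = i by apply: val_inj; rewrite /= kE addn0.
  subst k; rewrite shift_id; apply: joined_sym.
  by apply: joined_cell => //; apply: stratum_ge; exact: set_valP.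
have i1 : (i.+1 < size tau)%N.
  by apply: leq_ltn_trans (ltn_ord k); rewrite kE addnS ltnS leq_addr.
pose j := Ordinal i1; have ij : tau`_i <= tau`_j by exact/ltW/(strat_lt tauP).
have jk : tau`_j <= tau`_k.
  rewrite (lt_sorted_leq_nth 0 (strat_sorted tauP)) ?inE//=.
  by rewrite kE addnS ltnS leq_addr.
have top : tau`_j \in stratum tau i.
  by apply/mem_set; rewrite /stratum i1 /= in_itv /= ij lexx.
pose u' : cell (existT _ i a : cell_index S tau) := exist _ tau`_j top.
have uu' : set_val u <= set_val u'.
  have := set_valP u; rewrite {1}/stratum /= i1 /= in_itv /=.
  by case/andP.
apply: (joined_trans (y := to_real (cell_pt u'))).
  by apply: joined_cell => //; exact: le_trans kt.
have -> : to_real (cell_pt u') = to_real (base_pt (shift ij a)).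
  by apply/to_realP/rst_step; split=> //; exists ij.
rewrite -(shift_comp ij jk h).
by apply: IH => //; [rewrite kE addnS|exact: le_trans jk kt].
Qed.

(** Both points are joined to base points over the last time up to t. The shift from that time to t
    is injective, so equal values force the same base point. *)
Lemma val_at_joined t (x y : realization S tau) (hx : height x <= t)
    (hy : height y <= t) :
  val_at hx = val_at hy -> joined (sublevel t) x y.
Proof.
have xt := le_trans (cell_base (repr x)) hx.
have t0 : tau`_0 <= t.
  apply: le_trans xt; rewrite (lt_sorted_leq_nth 0 (strat_sorted tauP)) ?inE//.
    exact: strat_size tauP.
  exact: ltn_ord.
have [k0 [ks kt kmax]] := strat_floor tauP t0; pose k := Ordinal ks.
have to_base p (hp : cell_height p <= t) : exists2 a : S tau`_k,
    shift (kt : tau`_k <= t) a = cell_val hp &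
    joined (sublevel t) (to_real p) (to_real (base_pt a)).
  case: p hp => [[i a] u] hp.
  have ik : (i <= k)%N.
    rewrite leqNgt; apply/negP => /kmax/(_ (ltn_ord i)).
    by rewrite ltNge (le_trans (cell_base _) hp).
  have h : tau`_i <= tau`_k.
    by rewrite (lt_sorted_leq_nth 0 (strat_sorted tauP)) ?inE.
  exists (shift h a); first exact: shift_comp.
  by apply: (@joined_base (k - i)) => //; rewrite subnKC.
have [a ea] := to_base _ hx; have [c ec] := to_base _ hy.
rewrite !to_realK => jc ja; rewrite /val_at -ea -ec => e.
have [|u|f fK _] := strat_bij tauP (kt : tau`_k <= t).
- by rewrite (lt_sorted_leq_nth 0 (strat_sorted tauP)) ?inE// (strat_size tauP).
- move=> /(nthP 0)[m ms <-].
  by rewrite (lt_sorted_ltn_nth 0 (strat_sorted tauP))// => /kmax; exact.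
by apply: joined_trans ja _; rewrite (can_inj fK e); exact: joined_sym.
Qed.

Lemma val_at_surj t (x : S t) :
  exists z : realization S tau, exists h : height z <= t, val_at h = x.
Proof.
have [s [/(nthP 0)[k ks <-] s0 h gap]] := strat_prev tauP x.
have [f _ fK] := strat_bij tauP h s0 gap.
pose a : S tau`_(Ordinal ks) := f x.
have ht : height (to_real (base_pt a)) <= t by rewrite height_to_real.
have hb : cell_height (base_pt a) <= t by [].
exists (to_real (base_pt a)), ht.
by rewrite (val_at_to_real ht hb) -[RHS]fK; congr shift; exact: Prop_irrelevance.
Qed.

(** A component goes to the value of any of its points: [joined_val_at] gives independence of the
    point, [val_at_joined] injectivity, [val_at_surj] surjectivity. *)
Lemma sublevel_pi0_realization (T : rtree R) :
  rtree_iso T (realization S tau) -> persistent_iso (sublevel_pi0 T) S.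
Proof.
move=> [f [g [fK gK fc gc fh]]].
have gh z : height (g z) = height z by rewrite -fh gK.
have fle t x : sublevel t x -> height (f x) <= t by rewrite fh.
have rep t (C : sublevel_pi0 T t) :
    {x : T | sublevel t x & sval C = joined (sublevel t) x}.
  exact: cid2 (svalP C).
pose F t (C : sublevel_pi0 T t) : S t := val_at (fle _ _ (s2valP (rep t C))).
have FE t (C : sublevel_pi0 T t) x (xt : sublevel t x) :
    sval C x -> F t C = val_at (fle _ _ xt).
  rewrite /F; case: (rep t C) => y yt /= Cy yx.
  have {}yx : joined (sublevel t) y x by rewrite -Cy.
  exact/joined_val_at/joined_image.
have joinedE t (x y : T) : joined (sublevel t) x y ->
    joined (sublevel t) x = joined (sublevel t) y.
  move=> xy; apply/seteqP; split=> z; first exact/joined_trans/joined_sym.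
  exact: joined_trans.
apply: (persistent_iso_bij (f := F)).
- move=> t C D; rewrite /F.
  case: (rep t C) => x xt /= Cx; case: (rep t D) => y yt /= Dy.
  move=> /val_at_joined/(joined_image gc gh); rewrite !fK => /joinedE e.
  by apply: eq_sig_hprop => [?|]; [exact: Prop_irrelevance|rewrite Cx Dy].
- move=> t v; have [z [zt <-]] := val_at_surj v.
  have gzt : sublevel t (g z) by rewrite /sublevel /= gh.
  pose C : sublevel_pi0 T t := exist _ (joined (sublevel t) (g z))
    (ex_intro2 _ _ (g z) gzt erefl).
  exists C; rewrite (FE t C (g z) gzt); last exact: joined_refl.
  by apply: joined_val_at; rewrite gK; apply: joined_refl.
move=> r t h C; have [x xr Cx] := rep r C.
have xt : sublevel t x by exact: sublevel_sub h _ xr.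
rewrite (FE r C x xr); last by rewrite Cx; exact: joined_refl.
rewrite (FE t _ x xt); first exact/esym/shift_val_at.
by exists x; [rewrite Cx; exact: joined_refl|exact: joined_refl].
Qed.

End Paths.

(** * Functoriality of the realization *)

Section RealizationMap.
Context {R : realType} (S S' : persistent_set R) (tau : seq R).
Context (f : forall t, S t -> S' t).
Context (fN : forall r t (h : r <= t) x, f (shift h x) = shift h (f x)).

Definition cells_map (p : cells S tau) : cells S' tau :=
  let: existT c u := p in
  @cell_pt R S' tau (existT _ (tag c) (f (tagged c))) u.

(** On each summand this is the identity of a stratum, viewed as a map to another copy of it. *)
Lemma cells_map_continuous : continuous cells_map.
Proof. by move=> [c u] U. Qed.

Lemma to_real_cells_map p q :
  to_real p = to_real q -> to_real (cells_map p) = to_real (cells_map q).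
Proof.
move=> /to_realP pq; apply/to_realP; elim: pq => {p q}.
- move=> [[i a] u] [[j c] v] [/= e1 e2 e3 [h e]]; apply: rst_step; split=> //.
  exists h; rewrite /cells_map /= /cell_elt /= in e *.
  by rewrite -e fN.
- by move=> p; exact: rst_refl.
- by move=> p q _; exact: rst_sym.
- by move=> p q r _ pq _; exact: rst_trans pq.
Qed.

Definition realization_map (z : realization S tau) : realization S' tau :=
  to_real (cells_map (repr z)).

Lemma realization_map_to_real p :
  realization_map (to_real p) = to_real (cells_map p).
Proof. by apply: to_real_cells_map; exact: to_realK. Qed.

Lemma realization_map_continuous : continuous realization_map.
Proof.
apply: (@repr_comp_continuous _ _ _ (@to_real R S' tau \o cells_map)).
  move=> p; apply: continuous_comp; first exact: cells_map_continuous.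
  exact: to_real_continuous.
by move=> p q /eqP pq; apply/eqP; exact: to_real_cells_map.
Qed.

Lemma height_realization_map z : height (realization_map z) = height z.
Proof.
rewrite -{2}(to_realK z) /realization_map !height_to_real.
by case: (repr z).
Qed.

End RealizationMap.

Lemma realization_mapK (R : realType) (S S' : persistent_set R) (tau : seq R)
    (f : forall t, S t -> S' t) (g : forall t, S' t -> S t) :
  (forall r t (h : r <= t) x, g t (shift h x) = shift h (g r x)) ->
  (forall t, cancel (f t) (g t)) ->
  cancel (@realization_map R S S' tau f) (@realization_map R S' S tau g).
Proof.
move=> gN fK z; rewrite -{2}(to_realK z) [X in realization_map _ X]/realization_map.
rewrite (realization_map_to_real gN).
by congr to_real; case: (repr z) => [[i a] u]; rewrite /cells_map /cell_pt /= fK.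
Qed.

Lemma realization_iso (R : realType) (S S' : persistent_set R) (tau : seq R) :
  persistent_iso S S' -> rtree_iso (realization S tau) (realization S' tau).
Proof.
move=> [f [g [fK gK fN]]].
have gN r t (h : r <= t) x : g t (shift h x) = shift h (g r x).
  by apply: (can_inj (fK t)); rewrite fN !gK.
exists (@realization_map R S S' tau f), (@realization_map R S' S tau g); split.
- exact: realization_mapK.
- exact: realization_mapK.
- exact: realization_map_continuous.
- exact: realization_map_continuous.
- exact: height_realization_map.
Qed.

(** * Trees and parent maps *)

Section LabelTransfer.
Context {R : realType} (N : nat) (b d : nat -> R) (p : nat -> nat).

Lemma labelled_transfer (S S' : persistent_set R) (lab' : forall t, S' t -> nat) :
  persistent_iso S S' -> labelled N b d p lab' ->
  exists lab, @labelled R N b d p S lab.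
Proof.
move=> [f [g [fK gK fN]]] labP; exists (fun t x => lab' t (f t x)); split.
- by move=> t x y /(lab_inj labP)/(can_inj (fK t)).
- by move=> t x; exact: (lab_valid labP).
- by move=> t j /(lab_surj labP)[x <-]; exists (g t x); rewrite gK.
- by move=> r t h x; rewrite fN (lab_shift labP).
Qed.

Lemma labelled_iso (S S' : persistent_set R) (lab : forall t, S t -> nat)
    (lab' : forall t, S' t -> nat) :
  labelled N b d p lab -> labelled N b d p lab' -> persistent_iso S S'.
Proof.
move=> labP labP'.
have ex t (x : S t) : exists y, lab' t y = lab t x.
  exact: (lab_surj labP' (lab_valid labP x)).
pose f t x := sval (cid (ex t x)).
have fE t x : lab' t (f t x) = lab t x by rewrite /f; case: cid.
apply: (persistent_iso_bij (f := f)).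
- by move=> t x y e; apply: (lab_inj labP); rewrite -!fE e.
- move=> t y; have [x e] := lab_surj labP (lab_valid labP' y).
  by exists x; apply: (lab_inj labP'); rewrite fE.
- move=> r t h x; apply: (lab_inj labP').
  by rewrite fE (lab_shift labP) (lab_shift labP') fE.
Qed.

Lemma ancestor_ext p' j t : parent_map N b p -> (1 <= j <= N)%N ->
  (forall k, (2 <= k <= N)%N -> p k = p' k) ->
  ancestor N d p t j = ancestor N d p' t j.
Proof.
move=> pP jN pp'; rewrite /ancestor; elim: {1 2}N => //= n <-.
have [kN _ _] := climbS d pP n t jN; move: (iter n _ j) kN => k kN.
case: ifPn => //; rewrite /bar_alive negb_or => /andP[k1 _].
by apply: pp'; lia.
Qed.

Lemma labelled_ext p' (S : persistent_set R) (lab : forall t, S t -> nat) :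
  parent_map N b p -> (forall k, (2 <= k <= N)%N -> p k = p' k) ->
  labelled N b d p lab -> labelled N b d p' lab.
Proof.
move=> pP pp' [h1 h2 h3 h4]; split=> // r t h x; rewrite h4.
by apply: ancestor_ext => //; have /and3P[] := h2 r x.
Qed.

End LabelTransfer.

(** A label names the bar onto which the lineage projects, and origins are unique, so both
    labellings coincide. Flowing bar j to [d j] then exhibits [p j] and [p' j] as one label. *)
Lemma labelled_parent (R : realType) N (b d : nat -> R) (S : persistent_set R)
    p p' (lab lab' : forall t, S t -> nat) : bars N b d ->
  parent_map N b p -> parent_map N b p' ->
  labelled N b d p lab -> labelled N b d p' lab' ->
  forall j, (2 <= j <= N)%N -> p j = p' j.
Proof.
move=> bd pP pP' labP labP' j jN.
have [o oP _] := label_origin bd pP labP.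
have labE y : label lab y = label lab' y.
  apply: (bar_inj bd); [exact: label_range labP y|exact: label_range labP' y|].
  by rewrite -(image_lineage bd pP labP oP) -(image_lineage bd pP' labP' oP).
have jN1 : (1 <= j <= N)%N by lia.
have [x xj] := lab_surj labP (valid_birth bd jN1).
have h : b j <= d j by exact/ltW/(bars_lt bd).
rewrite -(climb_death bd pP jN) -(climb_death bd pP' jN).
have xj' : lab' (b j) x = j.
  by have := labE (existT _ (b j) x); rewrite /label /= xj => <-.
have := labE (existT _ (d j) (shift h x)); rewrite /label /=.
by rewrite (lab_shift labP) (lab_shift labP') xj xj'.
Qed.

(** * The persistent set and the tree built from a parent map *)

Section BarPersistent.
Context {R : realType} (N : nat) (b d : nat -> R) (p : nat -> nat).
Context (pP : parent_map N b p).

Definition bar_level (t : R) : Type := {j : nat | bar_valid N b d t j}.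

Definition bar_shift r t (h : r <= t) (x : bar_level r) : bar_level t :=
  exist _ (ancestor N d p t (sval x)) (valid_climb pP h (svalP x)).

Lemma bar_shift_id r (h : r <= r) x : bar_shift h x = x.
Proof.
apply: val_inj => /=; apply: climb_alive.
by have /and3P[] := svalP x.
Qed.

Lemma bar_shift_comp r s t (rs : r <= s) (st : s <= t) (rt : r <= t) x :
  bar_shift st (bar_shift rs x) = bar_shift rt x.
Proof.
apply: val_inj => /=; apply: (climb_comp d pP st).
by have /and3P[] := svalP x.
Qed.

Definition bar_persistent : persistent_set R :=
  PersistentSet bar_shift_id bar_shift_comp.

Lemma bar_labelled :
  @labelled R N b d p bar_persistent (fun t x => sval x).
Proof.
split=> //; first by move=> t x y /val_inj.
  by move=> t [].
by move=> t j jv; exists (exist _ j jv).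
Qed.

Context (bd : bars N b d).

Definition bar_morse : morse_set R :=
  MorseSet (labelled_morse bd pP bar_labelled).

Definition bar_tree : rtree R := realization bar_morse (times bar_morse).

Lemma bar_tree_subproof : exists2 T, morse_tree T & rtree_iso bar_tree = rtree_iso T.
Proof. by exists bar_tree => //; exists bar_morse; exact: rtree_iso_refl. Qed.

Definition bar_class : morse_tree_class R := exist _ _ bar_tree_subproof.

End BarPersistent.

Section Classes.
Context {R : realType}.

Lemma class_eq (X : morse_tree_class R) T :
  rtree_iso (class_repr X) T -> sval X = rtree_iso T.
Proof.
rewrite /class_repr; case: cid2 => T' _ /= ->; move=> e.
apply/funext => T''; apply/propext; split=> h.
  exact: rtree_iso_trans (rtree_iso_sym e) h.
exact: rtree_iso_trans e h.
Qed.

Lemma class_reprP (X : morse_tree_class R) T :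
  sval X = rtree_iso T -> rtree_iso (class_repr X) T.
Proof.
rewrite /class_repr; case: cid2 => T' _ /= -> e.
by rewrite e; exact: rtree_iso_refl.
Qed.

Lemma class_repr_morse (X : morse_tree_class R) : morse_tree (class_repr X).
Proof. by rewrite /class_repr; case: cid2. Qed.

Context (N : nat) (b d : nat -> R) (bd : bars N b d).
Context (B : barcode R) (BE : forall J, B J = count_mem J (bar_seq N b d)).

(** [elder_map] ranges over all Morse sets on this functor; the labelling provides one, and gives
    every one of them the barcode B. *)
Lemma elder_map_labelled (T : rtree R) p lab : parent_map N b p ->
  @labelled R N b d p (sublevel_pi0 T) lab -> elder_map T = B.
Proof.
move=> pP labP; apply: xget_unique => [|B' [S SE <-]].
  exists (MorseSet (labelled_morse bd pP labP)) => //.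
  exact: (elder_labelled bd BE (S := MorseSet (labelled_morse bd pP labP)) pP labP).
by rewrite -SE in lab labP; exact: (elder_labelled bd BE pP labP).
Qed.

Lemma Xi_bar_class p (pP : parent_map N b p) : Xi (bar_class pP bd) = B.
Proof.
have iso := class_reprP (erefl (sval (bar_class pP bd))).
have tauP := morse_strat (morse_setP (bar_morse pP bd)).
have [lab] := labelled_transfer (sublevel_pi0_realization tauP iso)
  (bar_labelled d pP).
exact: elder_map_labelled.
Qed.

Lemma bar_class_surj X : Xi X = B ->
  exists p, exists pP : parent_map N b p, X = bar_class pP bd.
Proof.
move=> XB; have [S isoS] := class_repr_morse X.
have [S' S'E S'B] : exists2 S' : morse_set R,
    morse_fun S' = sublevel_pi0 (class_repr X) & elder_barcode S' = B.
  move: XB; rewrite /Xi /elder_map; case: xgetP => [B' _ [S' e1 e2] <-|_ eB].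
    by exists S'.
  by case: (barcode_neq_point bd BE).
have [p [lab [pP labP]]] := morse_labels bd BE S'B.
rewrite S'E in lab labP.
have tauP := morse_strat (morse_setP S).
have iso := sublevel_pi0_realization tauP isoS.
have [lab1 labP1] := labelled_transfer (persistent_iso_sym iso) labP.
exists p, pP; apply: eq_sig_hprop => [?|]; first exact: Prop_irrelevance.
apply: class_eq; apply: rtree_iso_trans isoS _.
(* [realization_iso] compares realizations over one sequence of times; the labels force the times of
   S to be the critical ones, as in [bar_morse]. *)
rewrite (labelled_times bd pP labP1 (morse_setP S)).
exact/realization_iso/(labelled_iso labP1 (bar_labelled d pP)).
Qed.

Lemma bar_class_eq p p' (pP : parent_map N b p) (pP' : parent_map N b p') :
  (forall j, (2 <= j <= N)%N -> p j = p' j) <->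
  bar_class pP bd = bar_class pP' bd.
Proof.
split=> [pp'|/(congr1 sval)/= e].
  apply: eq_sig_hprop => [?|/=]; first exact: Prop_irrelevance.
  have iso : rtree_iso (bar_tree pP bd) (bar_tree pP' bd).
    apply/realization_iso/labelled_iso; last exact: bar_labelled.
    exact: labelled_ext (bar_labelled d pP).
  apply/funext => T; apply/propext; split=> h.
    exact: rtree_iso_trans (rtree_iso_sym iso) h.
  exact: rtree_iso_trans iso h.
have iso : rtree_iso (bar_tree pP bd) (bar_tree pP' bd).
  by rewrite e; exact: rtree_iso_refl.
have tauP := morse_strat (morse_setP (bar_morse pP bd)).
have tauP' := morse_strat (morse_setP (bar_morse pP' bd)).
(* Both labellings are brought to the component functor of the same tree, where [labelled_parent]
   applies. *)
have [lab labP] := labelled_transfer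
  (sublevel_pi0_realization tauP (rtree_iso_refl _)) (bar_labelled d pP).
have [lab' labP'] := labelled_transfer
  (sublevel_pi0_realization tauP' iso) (bar_labelled d pP').
exact: labelled_parent bd pP pP' labP labP'.
Qed.

End Classes.

(** * Counting parent maps *)

Section Counting.
Context {R : realType} (N : nat) (b d : nat -> R) (bd : bars N b d).
Context (B : barcode R) (BE : forall J, B J = count_mem J (bar_seq N b d)).
Local Notation bar := (bar_set b d).

Definition is_parent (j k : nat) : bool := [&& (1 <= k)%N, (k < j)%N & b k < b j].

(** Indices 0 and 1 have no parent; the forced value [ord0] makes each of them contribute a factor 1
    to the size of the family. *)
Definition parent_choices (j k : 'I_N.+1) : bool :=
  if (2 <= j)%N then is_parent j k else k == ord0.

Definition parent_fam := family (fun j => [pred k | parent_choices j k]).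

Lemma parent_fam_map (p : {ffun 'I_N.+1 -> 'I_N.+1}) :
  p \in parent_fam -> parent_map N b (fun j => p (inord j)).
Proof.
move=> /familyP pF j /andP[j2 jN]; have := pF (inord j).
by rewrite inE /parent_choices inordK// j2 => /and3P[].
Qed.

Lemma trees_cardinal :
  has_cardinal (fun X : morse_tree_class R => Xi X = B) #|parent_fam|.
Proof.
pose f (i : 'I_#|parent_fam|) := bar_class (parent_fam_map (enum_valP i)) bd.
exists f => [i k|X].
  rewrite /f => /bar_class_eq e; apply: enum_val_inj; apply/ffunP => j.
  have [j2|j2] := leqP 2 j.
    have jN : (2 <= j <= N)%N by rewrite j2 -ltnS ltn_ord.
    by have := e j jN; rewrite inord_val => /val_inj.
  have small (m : 'I_#|parent_fam|) : enum_val m j = ord0.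
    have /familyP/(_ j) := enum_valP m.
    by rewrite inE /parent_choices leqNgt j2 => /eqP.
  by rewrite !small.
split=> [XB|[i <-]]; last exact: Xi_bar_class.
have [p [pP ->]] := bar_class_surj bd BE XB.
pose q := [ffun j : 'I_N.+1 => if (2 <= j)%N then inord (p j) else ord0 : 'I_N.+1].
have pN j : (2 <= j <= N)%N -> (p j < N.+1)%N.
  by move=> jN; have [_ pj _] := pP j jN; lia.
have qF : q \in parent_fam.
  apply/familyP => j; rewrite inE /parent_choices ffunE.
  have [j2|_] := boolP (2 <= j)%N; last exact: eqxx.
  have jN : (2 <= j <= N)%N by rewrite j2 -ltnS ltn_ord.
  by rewrite /is_parent inordK ?pN//; apply/and3P; exact: pP.
exists (enum_rank_in qF q); apply/bar_class_eq => j jN.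
rewrite enum_rankK_in// ffunE inordK; last by lia.
by case/andP: (jN) => -> _; rewrite inordK ?pN.
Qed.

(** If j < k, bar k would contain [b j] and end at [d k], before bar j does; so [d k] would lie in
    bar j but not in bar k. For births only the weak inequality follows. *)
Lemma bar_proper j k : (2 <= j <= N)%N -> (1 <= k <= N)%N ->
  bar j `<` bar k -> (k < j)%N /\ b k <= b j.
Proof.
move=> jN kN [sub nsub]; have jN1 : (1 <= j <= N)%N by lia.
have bj : bar j (b j) by rewrite /bar_set /= lexx (alive_birth bd jN1).
have /andP[bkj akj] := sub _ bj; split=> //.
rewrite ltnNge leq_eqVlt; apply/negP => /predU1P[jk|jk].
  by apply: nsub; rewrite jk.
have dkj : d k < d j by apply: (bars_decr bd) => //; lia.
have bdk : b j < d k.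
  by move: akj; rewrite /bar_alive; case: eqP => //; lia.
have : bar j (d k) by rewrite /bar_set /= (ltW bdk) /bar_alive dkj orbT.
by move=> /sub; rewrite /bar_set /= /bar_alive ltxx orbF => /andP[_ /eqP]; lia.
Qed.

Lemma parent_proper j k : (2 <= j <= N)%N -> is_parent j k ->
  bar j `<` bar k /\ older (bar k) (bar j).
Proof.
move=> jN /and3P[k1 kj bkj]; have kN : (1 <= k <= N)%N by lia.
have bk : bar k (b k) by rewrite /bar_set /= lexx (alive_birth bd kN).
split; last first.
  by exists (b k) => // t /andP[bjt _]; exact: lt_le_trans bjt.
split=> [t /andP[bjt ajt]|/(_ _ bk)/andP[]]; last by rewrite leNgt bkj.
rewrite /bar_set /= (le_trans (ltW bkj) bjt) /bar_alive; case: eqP => //= k1'.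
have dj : d j < d k by apply: (bars_decr bd) => //; lia.
move: ajt; rewrite /bar_alive => /predU1P[|/lt_trans]; [lia|exact].
Qed.

Lemma bar_mem K : (B K != 0%N) <-> exists2 k, (1 <= k <= N)%N & K = bar k.
Proof.
rewrite BE -lt0n -has_count has_pred1.
by split=> /bar_seqP.
Qed.

Lemma parents_count (j : 'I_N.+1) : (2 <= j)%N ->
  #|` fset_set [set K | exists2 k, is_parent j k & K = bar k] |%fset =
  #|[pred k | parent_choices j k]|.
Proof.
move=> j2; have jN : (j <= N)%N by rewrite -ltnS.
pose s := [seq bar k | k <- iota 0 N.+1 & is_parent j k].
rewrite (_ : [set K | _] = [set` [fset K in s]%fset]); last first.
  apply/seteqP; split=> K /=.
    move=> [k kj ->]; rewrite inE /=; apply: map_f.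
    by rewrite mem_filter kj mem_iota; case/and3P: kj; lia.
  by rewrite inE => /mapP[k]; rewrite mem_filter => /andP[kj _] ->; exists k.
rewrite set_fsetK card_fseq undup_id; last first.
  rewrite map_inj_in_uniq ?filter_uniq ?iota_uniq// => k l.
  rewrite !mem_filter => /andP[/and3P[k1 kj _] _] /andP[/and3P[l1 lj _] _].
  by apply: (bar_inj bd); lia.
rewrite size_map size_filter -sum1_card.
under eq_bigl do rewrite inE /parent_choices j2.
by rewrite -(big_mkord (is_parent j) (fun=> 1%N)) sum1_count /index_iota subn0.
Qed.

(** Comparing a point of bar k that precedes all of bar j with [b j] itself turns [older] into b k <
    b j. *)
Lemma mu_older_parents (j : 'I_N.+1) : (2 <= j)%N ->
  mu_older B (bar j) = #|[pred k | parent_choices j k]|.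
Proof.
move=> j2; have jN : (2 <= j <= N)%N by rewrite j2 -ltnS ltn_ord.
rewrite -parents_count// /mu_older; congr (#|` fset_set _ |%fset).
apply/seteqP; split=> K /= => [[/bar_mem[k kN ->] jk [t kt lt]]|[k kj ->]].
  have [kj _] := bar_proper jN kN jk.
  exists k => //; apply/and3P; split=> //; first by case/andP: kN.
  case/andP: kt => bkt _; apply: le_lt_trans bkt (lt _ _).
  by rewrite /bar_set /= lexx (alive_birth bd)//; lia.
have [h1 h2] := parent_proper jN kj; split=> //.
by apply/bar_mem; exists k => //; case/and3P: kj; lia.
Qed.

(** Containment alone yields b k <= b j; injectivity of [b] excludes equality. *)
Lemma mu_parents (j : 'I_N.+1) :
  (forall j k, (1 <= j <= N)%N -> (1 <= k <= N)%N -> b j = b k -> j = k) ->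
  (2 <= j)%N -> mu B (bar j) = #|[pred k | parent_choices j k]|.
Proof.
move=> b_inj j2; have jN : (2 <= j <= N)%N by rewrite j2 -ltnS ltn_ord.
rewrite -parents_count// /mu; congr (#|` fset_set _ |%fset).
apply/seteqP; split=> K /= => [[/bar_mem[k kN ->] jk]|[k kj ->]].
  have [kj bkj] := bar_proper jN kN jk.
  exists k => //; apply/and3P; split=> //; first by case/andP: kN.
  rewrite lt_neqAle bkj andbT; apply/eqP => /b_inj e.
  by move: kj; rewrite e ?ltnn//; lia.
have [h1 h2] := parent_proper jN kj; split=> //.
by apply/bar_mem; exists k => //; case/and3P: kj; lia.
Qed.

Lemma card_parent_fam : #|parent_fam| =
  (\prod_(2 <= j < N.+1) #|[pred k : 'I_N.+1 | is_parent j k]|)%N.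
Proof.
rewrite card_family foldrE big_image /= big_geq_mkord [RHS]big_mkcond /=.
apply: eq_bigr => j _; case: ifPn => j2.
  by apply: eq_card => k; rewrite !inE /parent_choices j2.
rewrite -(card1 (ord0 : 'I_N.+1)); apply: eq_card => k.
by rewrite !inE /parent_choices (negbTE j2).
Qed.

End Counting.

(* Counting all strict containments requires distinct left endpoints, as e.g.
   [0, oo), [1, 5), [1, 4) shows.  In general only the bars whose left endpoint
   is strictly smaller count; both counts agree for distinct left endpoints. *)
Theorem theorem4p8 (R : realType) (N : nat) (b d : nat -> R) (I : nat -> set R)
    (B : barcode R)
    (N_gt0 : (1 <= N)%N)
    (I1 : I 1%N = `[b 1%N, +oo[%classic)
    (Ij : forall j, (2 <= j <= N)%N ->
      [/\ b j < d j, I j = `[b j, d j[%classic & I j `<` I 1%N])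
    (d_decr : forall j, (2 <= j)%N -> (j.+1 <= N)%N -> d j.+1 < d j)
    (BE : forall J, B J = (\sum_(1 <= j < N.+1) (I j == J))%N) :
  ((forall j k, (1 <= j <= N)%N -> (1 <= k <= N)%N -> b j = b k -> j = k) ->
    has_cardinal (fun X : morse_tree_class R => Xi X = B)
      (\prod_(2 <= j < N.+1) mu B (I j))%N) /\
  has_cardinal (fun X : morse_tree_class R => Xi X = B)
    (\prod_(2 <= j < N.+1) mu_older B (I j))%N.
Proof.
have IE j : (1 <= j <= N)%N -> I j = bar_set b d j.
  move=> jN; have [->|j1] := eqVneq j 1%N.
    by rewrite I1; apply/seteqP; split=> t; rewrite /bar_set /bar_alive /= in_itv.
  have [_ -> _] : [/\ b j < d j, I j = `[b j, d j[%classic & I j `<` I 1%N].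
    by apply: Ij; lia.
  apply/seteqP; split=> t; rewrite /bar_set /bar_alive /= in_itv /=;
    by rewrite (negbTE j1).
have bd : bars N b d.
  split=> //.
  - by move=> j /Ij[].
  - move=> j jN; have [->//|j1] := eqVneq j 1%N.
    have [|bdj -> [sub _]] := Ij j; first by lia.
    have : `[b j, d j[%classic (b j) by rewrite /= in_itv /= lexx.
    by move/sub; rewrite I1 /= in_itv /= andbT.
  - move=> j k j2; elim: k => // k IH; rewrite ltnS leq_eqVlt => /predU1P[<-|jk] kN.
      exact: d_decr.
    apply: lt_trans (IH jk (ltnW kN)); apply: d_decr => //; lia.
have BE' J : B J = count_mem J (bar_seq N b d).
  rewrite BE count_map -sum1_count [RHS]big_mkcond /index_iota subn1 /=.
  rewrite big_seq [RHS]big_seq; apply: eq_bigr => j; rewrite mem_iota => jN.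
  by rewrite IE; [case: eqP|lia].
have card := trees_cardinal bd BE'; rewrite card_parent_fam in card.
have prodE (m : set R -> nat) :
    (forall j : 'I_N.+1, (2 <= j)%N ->
      m (bar_set b d j) = #|[pred k : 'I_N.+1 | parent_choices b j k]|) ->
    (\prod_(2 <= j < N.+1) m (I j) =
     \prod_(2 <= j < N.+1) #|[pred k : 'I_N.+1 | is_parent b j k]|)%N.
  move=> mE; rewrite !big_geq_mkord; apply: eq_bigr => j /= j2.
  rewrite IE; last by have := ltn_ord j; lia.
  by rewrite mE//; apply: eq_card => k; rewrite !inE /parent_choices j2.
split=> [b_inj|]; rewrite prodE// => j j2.
  exact: (mu_parents bd BE').
exact: (mu_older_parents bd BE').
Qed.
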